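(* There is a universal constant $c>0$ such that for every integer $n\ge1$ and every rank $n$ lattice $\Lambda\subseteq\mathbb{R}^n$ whose dual lattice satisfies $N(\Lambda^* )=1$ and $r(\Lambda^* )\le 4$, one has $$c_1(\mathbb{R}^n/\Lambda)\ge c\sqrt{n}.$$ Since such lattices exist for every $n$, in particular for every $n$ there is a lattice $\Lambda\subseteq\mathbb{R}^n$ of rank $n$ with $c_1(\mathbb{R}^n/\Lambda)\ge c\sqrt n$.
   Context: For a rank $n$ lattice $\Lambda\subseteq\mathbb{R}^n$, the dual lattice is $\Lambda^*=\{x\in\mathbb{R}^n:\ \forall y\in\Lambda,\ \langle x,y\rangle\in\mathbb{Z}\}$, and $N(\Lambda)=\min_{x\in\Lambda\setminus\{0\}}\|x\|_2$, $r(\Lambda)=\max_{x\in\mathbb{R}^n}\min_{y\in\Lambda}\|x-y\|_2$. The flat torus $\mathbb{R}^n/\Lambda$ carries its Riemannian (quotient) metric $d_{\mathbb{R}^n/\Lambda}(x+\Lambda,y+\Lambda)=\min_{z\in\Lambda}\|x-y-z\|_2$. Distortion: for metric spaces $(X,d_X),(Y,d_Y)$ and $f:X\to Y$, $\|f\|_{\mathrm{Lip}}=\sup_{x\ne y} d_Y(f(x),f(y))/d_X(x,y)$. If $f$ is one-to-one, $\mathrm{dist}(f)=\|f\|_{\mathrm{Lip}}\cdot\|f^{-1}\|_{\mathrm{Lip}}$ (with $f^{-1}$ defined on $f(X)$); otherwise $\mathrm{dist}(f)=\infty$. $c_Y(X)=\inf\{\mathrm{dist}(f): f:X\to Y\}$,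 and $c_1(X)=c_{L_1}(X)$, where $L_1=L_1([0,1])$. *)

(* Defs.v *)
From HB Require Import structures.
From mathcomp Require Import all_boot all_order all_algebra.
From mathcomp Require Import ring lra zify.
From mathcomp Require Import generic_quotient ring_quotient.
From mathcomp Require Import all_classical all_reals all_analysis.
From mathcomp Require Import measurable_realfun.

Set Implicit Arguments.
Unset Strict Implicit.
Unset Printing Implicit Defensive.

Import Order.TTheory GRing.Theory Num.Theory.

Local Open Scope classical_set_scope.
Local Open Scope ring_scope.
Local Open Scope quotient_scope.

Section Euclidean.
Context {R : realType} {n : nat}.
Implicit Types u v : 'rV[R]_n.

Definition dotp u v : R := \sum_i u 0 i * v 0 i.

(* The norm that the library puts on 'rV[R]_n is the sup norm. *)
Definition enorm u : R := Num.sqrt (dotp u u).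

Lemma dotpE u v : dotp u v = (u *m v^T) 0 0.
Proof. by rewrite mxE; apply: eq_bigr => i _; rewrite mxE. Qed.

Lemma dotpC u v : dotp u v = dotp v u.
Proof. by apply: eq_bigr => i _; rewrite mulrC. Qed.

Lemma dotpDl u v w : dotp (u + v) w = dotp u w + dotp v w.
Proof. by rewrite -big_split; apply: eq_bigr => i _; rewrite mxE mulrDl. Qed.

Lemma dotpZl a u w : dotp (a *: u) w = a * dotp u w.
Proof. by rewrite mulr_sumr; apply: eq_bigr => i _; rewrite mxE mulrA. Qed.

Lemma dotp_ge0 u : 0 <= dotp u u.
Proof. by apply: sumr_ge0 => i _; rewrite -expr2 sqr_ge0. Qed.

Lemma dotp_cauchy u v : dotp u v ^+ 2 <= dotp u u * dotp v v.
Proof.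
have [v0|vN0] := eqVneq (dotp v v) 0.
  have vE i : v 0 i = 0.
    apply/eqP; rewrite -sqrf_eq0 expr2.
    move: v0 => /eqP; rewrite psumr_eq0; last first.
      by move=> j _; rewrite -expr2 sqr_ge0.
    by move=> /allP/(_ i); rewrite mem_index_enum => /(_ isT).
  rewrite v0 mulr0 [dotp u v]big1 ?expr0n// => i _.
  by rewrite vE mulr0.
have v_gt0 : 0 < dotp v v by rewrite lt_neqAle eq_sym vN0 dotp_ge0.
have := dotp_ge0 (dotp v v *: u + (- dotp u v) *: v).
have -> : dotp (dotp v v *: u + - dotp u v *: v)
               (dotp v v *: u + - dotp u v *: v) =
    dotp v v * (dotp u u * dotp v v - dotp u v ^+ 2).
  rewrite dotpDl !dotpZl ![dotp _ (_ + _)]dotpC !dotpDl !dotpZl [dotp v u]dotpC.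
  by ring.
by rewrite pmulr_rge0// subr_ge0.
Qed.

Lemma enorm_ge0 u : 0 <= enorm u.
Proof. exact: sqrtr_ge0. Qed.

Lemma enorm0 : enorm 0 = 0.
Proof. by rewrite /enorm [dotp _ _]big1 ?sqrtr0// => i _; rewrite mxE mul0r. Qed.

Lemma enormN u : enorm (- u) = enorm u.
Proof. by congr Num.sqrt; apply: eq_bigr => i _; rewrite !mxE mulrNN. Qed.

Lemma enormB u v : enorm (u - v) = enorm (v - u).
Proof. by rewrite -enormN opprB. Qed.

Lemma enormD u v : enorm (u + v) <= enorm u + enorm v.
Proof.
rewrite -(@ler_pXn2r _ 2) ?nnegrE ?addr_ge0 ?enorm_ge0// sqrrD !sqr_sqrtr ?dotp_ge0//.
have -> : dotp (u + v) (u + v) = dotp u u + dotp u v *+ 2 + dotp v v.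
  by rewrite dotpDl ![dotp _ (_ + _)]dotpC !dotpDl [dotp v u]dotpC; ring.
rewrite lerD2r lerD2l lerMn2r/=; apply: le_trans (ler_norm _) _.
rewrite -sqrtr_sqr -sqrtrM ?dotp_ge0// ler_sqrt ?mulr_ge0 ?dotp_ge0//.
exact: dotp_cauchy.
Qed.

Lemma ler_coord_enorm u i : `|u 0 i| <= enorm u.
Proof.
rewrite -sqrtr_sqr ler_sqrt ?dotp_ge0// /dotp (bigD1 i)//= -expr2 lerDl.
by apply: sumr_ge0 => j _; rewrite -expr2 sqr_ge0.
Qed.

End Euclidean.

Section Lattice.
Context {R : realType} {n : nat}.

(* The basis of the lattice consists of the rows of an invertible matrix B. *)
Definition is_lattice (L : set 'rV[R]_n) : Prop :=
  exists2 B : 'M[R]_n, B \in unitmx &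
    L = [set map_mx intr z *m B | z in [set: 'rV[int]_n]].

Record lattice := Lattice {
  lattice_set :> set 'rV[R]_n ;
  latticeP : is_lattice lattice_set }.

Definition mem_lattice (L : lattice) : {pred 'rV[R]_n} :=
  [pred x | x \in lattice_set L].

Lemma lattice_zmod_closed (L : lattice) : zmod_closed (mem_lattice L).
Proof.
case: L => L [B Bu LE]; split=> [|x y]; rewrite !inE/= LE.
  by exists 0 => //; rewrite map_mx0 mul0mx.
by move=> [z _ <-] [w _ <-]; exists (z - w) => //; rewrite map_mxB mulmxBl.
Qed.

HB.instance Definition _ (L : lattice) :=
  GRing.isZmodClosed.Build _ (mem_lattice L) (lattice_zmod_closed L).

Lemma lattice_discrete (L : lattice) :
  exists2 e : R, 0 < e & forall x, lattice_set L x -> enorm x < e -> x = 0.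
Proof.
case: L => L [B Bu LE] /=.
pose C := 1 + \sum_i \sum_j `|invmx B i j|.
have C_gt0 : 0 < C by rewrite ltr_pwDl// !sumr_ge0// => i _; rewrite sumr_ge0.
exists C^-1; rewrite ?invr_gt0// => x; rewrite LE => -[z _ <-] zB_lt.
suff -> : z = 0 by rewrite map_mx0 mul0mx.
apply/rowP => j; rewrite mxE; apply/eqP; rewrite -(intr_eq0 R).
have zj : (z 0 j)%:~R = \sum_i (map_mx intr z *m B) 0 i * invmx B i j.
  have := congr1 (fun u : 'rV[R]_n => u 0 j) (mulmxK Bu (map_mx intr z)).
  by rewrite !mxE => <-; apply: eq_bigr.
have : `|(z 0 j)%:~R| < 1 :> R.
  rewrite zj; apply: le_lt_trans (ler_norm_sum _ _ _) _.
  apply: (@le_lt_trans _ _ (enorm (map_mx intr z *m B) * C)); last first.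
    by rewrite -ltr_pdivlMr// mul1r.
  rewrite (@le_trans _ _ (enorm (map_mx intr z *m B) *
                          \sum_i \sum_j `|invmx B i j|))//; last first.
    by rewrite ler_wpM2l ?enorm_ge0// lerDr.
  rewrite mulr_sumr; apply: ler_sum => i _; rewrite normrM.
  rewrite ler_pM ?ler_coord_enorm// (bigD1 j)//= lerDl.
  by apply: sumr_ge0.
by rewrite -intr_norm -[1]/(1%:~R) ltr_int intr_eq0; lia.
Qed.

Definition dual_set (L : set 'rV[R]_n) : set 'rV[R]_n :=
  [set x | forall y, L y -> dotp x y \is a Num.int].

Lemma dual_is_lattice (L : lattice) : is_lattice (dual_set L).
Proof.
case: L => L [B Bu LE] /=; exists (invmx B^T); rewrite ?unitmx_inv ?unitmx_tr//.
apply/seteqP; split => x /=.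
  move=> xL; exists (\row_j Num.floor ((x *m B^T) 0 j)) => //.
  rewrite -[RHS](mulmxK (_ : B^T \in unitmx)) ?unitmx_tr//; congr (_ *m _).
  apply/rowP => j; rewrite !mxE.
  have -> : \sum_k x 0 k * B^T k j = dotp x (row j B).
    by apply: eq_bigr => k _; rewrite !mxE.
  apply/eqP; rewrite -[_ == _]intrEfloor.
  apply: xL; rewrite LE; exists (delta_mx 0 j) => //.
  by rewrite map_delta_mx -rowE.
move=> [z _ <-] y; rewrite LE => -[w _ <-].
rewrite dotpE trmx_mul mulmxA mulmxKV ?unitmx_tr// mxE.
by apply: rpred_sum => i _; rewrite !mxE rpredM// intr_int.
Qed.

Definition dual (L : lattice) : lattice := Lattice (dual_is_lattice L).

(* The minima and maxima over an infinite set are written as infima and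
   suprema; for a lattice of positive rank they are attained. *)
Definition lattice_dist (L : lattice) (x : 'rV[R]_n) : R :=
  inf [set enorm (x - y) | y in L].

Definition shortest (L : lattice) : \bar R :=
  ereal_inf [set (enorm x)%:E | x in L `\ 0].

Definition covering_radius (L : lattice) : \bar R :=
  ereal_sup [set (lattice_dist L x)%:E | x in [set: 'rV[R]_n]].

Lemma lattice_dist_lbound (L : lattice) x :
  lbound [set enorm (x - y) | y in L] 0.
Proof. by move=> _ [y _ <-]; exact: enorm_ge0. Qed.

Lemma lattice0 (L : lattice) : lattice_set L 0.
Proof. by have [] := lattice_zmod_closed L; rewrite inE. Qed.

Lemma latticeB (L : lattice) x y :
  lattice_set L x -> lattice_set L y -> lattice_set L (x - y).
Proof.
move=> Lx Ly; have [_ LB] := lattice_zmod_closed L.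
by have := LB x y; rewrite !inE; exact.
Qed.

Lemma latticeN (L : lattice) x : lattice_set L x -> lattice_set L (- x).
Proof. by rewrite -[- x]add0r; apply: latticeB; exact: lattice0. Qed.

Lemma latticeD (L : lattice) x y :
  lattice_set L x -> lattice_set L y -> lattice_set L (x + y).
Proof. by move=> Lx Ly; rewrite -[y]opprK; exact/latticeB/latticeN. Qed.

Lemma has_inf_lattice_dist (L : lattice) x :
  has_inf [set enorm (x - y) | y in L].
Proof.
split; first by exists (enorm (x - 0)); exists 0 => //; exact: lattice0.
by exists 0; exact: lattice_dist_lbound.
Qed.

Lemma lattice_dist_le (L : lattice) x y :
  lattice_set L y -> lattice_dist L x <= enorm (x - y).
Proof.
by move=> Ly; apply: ge_inf; [exists 0; exact: lattice_dist_lbound|exists y].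
Qed.

Lemma lattice_dist_adh (L : lattice) x e : 0 < e ->
  exists2 y, lattice_set L y & enorm (x - y) < lattice_dist L x + e.
Proof.
move=> e0; have [_ [y Ly <-] xy] := inf_adherent e0 (has_inf_lattice_dist L x).
by exists y.
Qed.

Lemma lattice_distN (L : lattice) x : lattice_dist L (- x) = lattice_dist L x.
Proof.
suff le y : lattice_dist L (- y) <= lattice_dist L y.
  by apply/eqP; rewrite eq_le le/= -{1}[x]opprK le.
apply/ler_addgt0Pr => e /(lattice_dist_adh L y)[z Lz /ltW]; apply: le_trans.
by rewrite -enormN opprB addrC -[z]opprK lattice_dist_le//; exact: latticeN.
Qed.

Lemma lattice_distD (L : lattice) x y :
  lattice_dist L (x + y) <= lattice_dist L x + lattice_dist L y.
Proof.
apply/ler_addgt0Pr => e e0; have e2 : 0 < e / 2 by rewrite divr_gt0.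
have [z Lz zx] := lattice_dist_adh L x e2.
have [w Lw wy] := lattice_dist_adh L y e2.
apply: le_trans (lattice_dist_le _ (latticeD Lz Lw)) _.
rewrite opprD addrACA; apply: le_trans (enormD _ _) _.
by have := ltrD zx wy; lra.
Qed.

Lemma lattice_dist_eq0 (L : lattice) x : lattice_dist L x = 0 -> lattice_set L x.
Proof.
move=> x0; have [e e0 Le] := lattice_discrete L.
have e2 : 0 < e / 2 by rewrite divr_gt0.
have [y Ly] := lattice_dist_adh L x e2; rewrite x0 add0r => xy.
suff -> : x = y by [].
apply/eqP; rewrite -subr_eq0; apply/eqP/rowP => i; rewrite [RHS]mxE.
apply/eqP; rewrite -normr_le0; apply: le_trans (ler_coord_enorm _ _) _.
apply/ler_addgt0Pl => d d0; rewrite addr0.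
have m0 : 0 < Num.min d (e / 2) by rewrite lt_min d0.
have [z Lz] := lattice_dist_adh L x m0; rewrite x0 add0r lt_min => /andP[xzd xze].
suff -> : y = z by exact: ltW.
apply/eqP; rewrite -subr_eq0; apply/eqP/Le; first exact/latticeD/latticeN.
rewrite (_ : y - z = (y - x) + (x - z)); last by rewrite addrA subrK.
by rewrite (le_lt_trans (enormD _ _))// enormB; have := ltrD xy xze; lra.
Qed.

Lemma lattice_distDl (L : lattice) x y : lattice_set L x ->
  lattice_dist L (x + y) = lattice_dist L y.
Proof.
suff le u v : lattice_set L u -> lattice_dist L (u + v) <= lattice_dist L v.
  move=> Lx; apply/eqP; rewrite eq_le le//=.
  by rewrite -{1}(addKr x y) le//; exact: latticeN.
move=> Lu; apply: le_trans (lattice_distD _ _ _) _; rewrite gerDr.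
by apply: le_trans (lattice_dist_le u Lu) _; rewrite subrr enorm0.
Qed.

End Lattice.
Arguments lattice : clear implicits.

Section Torus.
Context {R : realType} {n : nat} (L : lattice R n).

Definition torus : Type := Quotient.quot (mem_lattice L).
HB.instance Definition _ := GRing.Zmodule.on torus.
HB.instance Definition _ := EqQuotient.on torus.

Definition torus_dist (p q : torus) : R := lattice_dist L (repr p - repr q).

Lemma torus_distE (x y : 'rV[R]_n) :
  torus_dist (\pi_torus x) (\pi_torus y) = inf [set enorm (x - y - z) | z in L].
Proof.
have reprE u : lattice_set L (repr (\pi_torus u) - u).
  have : repr (\pi_torus u) = u %[mod Quotient.quot (mem_lattice L)].
    exact: (reprK (\pi_torus u)).
  by move=> /eqP; rewrite -Quotient.idealrBE inE.
rewrite -[RHS]/(lattice_dist L (x - y)) /torus_dist.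
rewrite -(lattice_distDl (x - y) (latticeD (reprE x) (latticeN (reprE y)))).
congr (lattice_dist L _).
by apply/rowP => j; rewrite !mxE; ring.
Qed.

Lemma torus_distxx p : torus_dist p p = 0.
Proof.
rewrite /torus_dist subrr; apply/eqP; rewrite eq_le; apply/andP; split.
  by have := lattice_dist_le 0 (lattice0 L); rewrite subrr enorm0.
by apply: lb_le_inf (@lattice_dist_lbound _ _ _ _); have [] := has_inf_lattice_dist L 0.
Qed.

Lemma torus_dist_positivity p q : torus_dist p q = 0 -> p = q.
Proof.
move=> /lattice_dist_eq0 pq; rewrite -[p]reprK -[q]reprK.
by apply/eqP; rewrite -Quotient.idealrBE inE.
Qed.

Lemma torus_dist_sym p q : torus_dist p q = torus_dist q p.
Proof. by rewrite /torus_dist -lattice_distN opprB. Qed.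

Lemma torus_dist_triangle q p s :
  torus_dist p s <= torus_dist p q + torus_dist q s.
Proof.
rewrite /torus_dist; apply: le_trans (lattice_distD _ _ _).
by rewrite addrA subrK.
Qed.

HB.instance Definition _ := isMetric.Build R torus
  torus_distxx torus_dist_positivity torus_dist_sym torus_dist_triangle.

End Torus.

Section L1.
Context {R : realType}.

Definition lebesgue01 : {measure set (measurableTypeR R) -> \bar R} :=
  mrestr (@lebesgue_measure R) (measurable_itv `[0, 1]).

(* An element is a class of measurable functions on the real line, modulo
   equality almost everywhere on [0, 1], of finite L_1-norm over [0, 1]. *)
Definition L1 : Type := LspaceType1 lebesgue01.

HB.instance Definition _ := gen_eqMixin L1.
HB.instance Definition _ := gen_choiceMixin L1.

Definition L1_dist (f g : L1) : R :=
  fine ('N[lebesgue01]_1[EFin \o ((f : R -> R) \- g)%R])%E.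

Implicit Types f g h : L1.

Lemma L1_measurable f : measurable_fun [set: measurableTypeR R] f.
Proof. exact: measurable_funPT (repr (f : {mfun_ lebesgue01, _ >-> _})). Qed.

Lemma L1_finite f : ('N[lebesgue01]_1[EFin \o f] < +oo)%E.
Proof. exact: (@Lebesgue_finite _ _ _ _ _ _ f). Qed.

Lemma L1_measurableB f g : measurable_fun [set: measurableTypeR R] ((f : R -> R) \- g).
Proof. by apply: measurable_funB; exact: L1_measurable. Qed.

Lemma L1_distE f g : (L1_dist f g)%:E = 'N[lebesgue01]_1[EFin \o ((f : R -> R) \- g)%R]%E.
Proof.
rewrite /L1_dist fineK// fin_numElt (lt_le_trans ltNy0) ?Lnorm_ge0//=.
apply: (@le_lt_trans _ _ ('N[lebesgue01]_1[EFin \o f] +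
                          'N[lebesgue01]_1[EFin \o g])%E); last first.
  by rewrite lte_add_pinfty// L1_finite.
rewrite -[X in (_ <= _ + X)%E]oppe_Lnorm.
apply: (@eminkowski _ _ _ lebesgue01 f (\- (g : R -> R)) 1%E) => //.
- exact: L1_measurable.
- by apply: measurableT_comp => //; exact: L1_measurable.
Qed.

Lemma L1_distxx f : L1_dist f f = 0.
Proof.
have /(Lnorm0 lebesgue01) N0 : (1 != 0 :> \bar R)%E by rewrite gt_eqF.
apply: EFin_inj; rewrite L1_distE -[RHS]N0.
by apply: eq_Lnorm => x /=; rewrite subrr.
Qed.

Lemma L1_dist_positivity f g : L1_dist f g = 0 -> f = g.
Proof.
move=> fg0; have /measurable_EFinP mfg := L1_measurableB f g.
have {}fg0 : 'N[lebesgue01]_1[EFin \o ((f : R -> R) \- g)%R]%E = 0%E.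
  by rewrite -L1_distE fg0.
have {mfg}fg0 := Lnorm_eq0_eq0 mfg lte01 fg0.
have fg : (f : {mfun_ lebesgue01, _ >-> _}) = g.
  rewrite -[LHS]reprK -[RHS]reprK; apply/eqP/ae_eqP.
  apply: filterS fg0 => x /(_ I) [fgx] _.
  by apply/eqP; rewrite -subr_eq0; apply/eqP.
case: f g fg {fg0} => [f [[fP]]] [g [[gP]]] /= fg.
by move: fP gP; rewrite fg => fP gP; rewrite (Prop_irrelevance fP gP).
Qed.

Lemma L1_dist_sym f g : L1_dist f g = L1_dist g f.
Proof.
apply: EFin_inj; rewrite !L1_distE -oppe_Lnorm.
by apply: eq_Lnorm => x /=; rewrite opprB.
Qed.

Lemma L1_dist_triangle g f h : L1_dist f h <= L1_dist f g + L1_dist g h.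
Proof.
rewrite -lee_fin EFinD !L1_distE.
have := @eminkowski _ _ _ lebesgue01 ((f : R -> R) \- g) ((g : R -> R) \- h) 1%E
  (L1_measurableB _ _) (L1_measurableB _ _) (lexx _).
apply: le_trans; rewrite le_eqVlt; apply/orP; left; apply/eqP.
by apply: eq_Lnorm => x /=; rewrite addrA subrK.
Qed.

HB.instance Definition _ := isMetric.Build R L1
  L1_distxx L1_dist_positivity L1_dist_sym L1_dist_triangle.

End L1.
Arguments L1 : clear implicits.

Section Distortion.
Context {R : realType}.
Local Open Scope ereal_scope.

(* The Lipschitz constant of the restriction of f to A; 0 is put in the set so
   that it is the supremum when A has at most one point. *)
Definition lipschitz_norm {X Y : metricType R} (A : set X) (f : X -> Y) : \bar R :=
  ereal_sup (0 |` [set (mdist (f p.1) (f p.2) / mdist p.1 p.2)%:E | p in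
                   [set p | A p.1 /\ A p.2 /\ p.1 <> p.2]]).

(* The Lipschitz constant on f(X) of the inverse of a one-to-one map f. *)
Definition lipschitz_norm_inv {X Y : metricType R} (f : X -> Y) : \bar R :=
  ereal_sup (0 |` [set (mdist p.1 p.2 / mdist (f p.1) (f p.2))%:E | p in
                   [set p | p.1 <> p.2]]).

Lemma lipschitz_norm_invE {X Y : metricType R} (f : X -> Y) (g : Y -> X) :
  cancel f g -> lipschitz_norm_inv f = lipschitz_norm (range f) g.
Proof.
move=> fK; rewrite /lipschitz_norm_inv /lipschitz_norm; congr (ereal_sup (_ `|` _)).
apply/seteqP; split=> [_ [[x y] /= xy <-]|_ [[_ _] /= [[x _ <-] [[y _ <-] xy]] <-]].
  exists (f x, f y) => /=; last by rewrite !fK.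
  by split; [exists x|split; [exists y|move=> /(can_inj fK)]].
by exists (x, y) => /=; [move=> xy'; apply: xy; rewrite xy'|rewrite !fK].
Qed.

Definition distortion {X Y : metricType R} (f : X -> Y) : \bar R :=
  if `[< injective f >] then lipschitz_norm [set: X] f * lipschitz_norm_inv f
  else +oo.

(* c_Y(X), with the target space Y first *)
Definition distortion_in (Y X : metricType R) : \bar R :=
  ereal_inf (range (@distortion X Y)).

Definition c1 (X : metricType R) : \bar R := distortion_in (L1 R) X.

End Distortion.

(* Main.v *)
Require Import Defs.
From mathcomp Require Import all_boot all_order all_algebra.
From mathcomp Require Import ring lra zify.
From mathcomp Require Import all_classical all_reals all_analysis.
From mathcomp Require Import measurable_realfun.
From mathcomp Require Import complex.

Set Implicit Arguments.
Unset Strict Implicit.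
Unset Printing Implicit Defensive.

Import Order.TTheory GRing.Theory Num.Theory.

Local Open Scope ring_scope.

(** The torus is replaced by its subgroup G of m-torsion points, with m large.
A 0/1-valued function on G satisfies, by Plancherel, an L_1 Poincare inequality
comparing its mean change under a random step with its mean oscillation, as soon
as the step has a spectral gap: every nontrivial character moves by a definite
amount in mean. Writing real functions as combinations of cuts and integrating
over [0, 1] gives the same inequality for maps to L_1. Since the nonzero dual
vectors have norm at least 1, a step of mean length at most 3 sqrt n is enough.

On the other hand, at least half of the pairs of points of G are at distance at
least n/8192. Let A be the points closer than that to 0, and chi the Fourier
transform of A, extended to R^n through nearest lattice representatives. For a
random frequency eta, a discretized Gaussian with coordinates of order 1 / sqrt n,
|chi (eta)|^2 has mean at least 2^-n |A|^2. But eta is within 5 of the dual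
lattice, so the possible values of eta are spread over few translates of the dual
lattice, and on each of them the sum of |chi|^2 is at most |G| |A| by Plancherel.
Hence |A| <= |G|/2, and the distortion is at least of order n / sqrt n.

A lattice whose dual has the required invariants comes from a maximal
chain of lattices containing Z^n, each obtained from the previous one by adding
half of a vector, at distance at least 1 from all the points. *)

(** * Elementary bounds on sine, cosine and sums of cosines *)

Section Trigonometry.
Context {R : realType}.
Implicit Types t x y : R.

(** The mean value theorem. Applied repeatedly below, it raises the degree of Taylor bounds, from
    [sin x <= x] to a quadratic bound on [cos] and a cubic one on [sin]. *)
Lemma ge0_of_derive (f df : R -> R) : 0 <= f 0 ->
    (forall x, is_derive x 1 f (df x)) -> (forall x, 0 <= x -> 0 <= df x) ->
  forall x, 0 <= x -> 0 <= f x.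
Proof.
move=> f0 fd df0 x x0.
have [c /andP[c0 _]] : exists2 c, c \in `[0, x]%R & f x - f 0 = df c * (x - 0).
  apply: (MVT_segment x0) => //; apply: derivable_within_continuous => y _.
  by have [] := fd y.
by move=> fx; apply: le_trans f0 _; rewrite -subr_ge0 fx mulr_ge0 ?subr_ge0 ?df0.
Qed.

Lemma ler_sin_id x : 0 <= x -> sin x <= x.
Proof.
move=> x0; rewrite -subr_ge0.
apply: (@ge0_of_derive (fun x => x - sin x) (fun x => 1 - cos x)) => //.
by rewrite sin0 subrr.
Qed.

Lemma cos_ge_pos x : 0 <= x -> 1 - x ^+ 2 / 2 <= cos x.
Proof.
move=> x0; rewrite -subr_ge0.
apply: (@ge0_of_derive (fun x => cos x - (1 - x ^+ 2 / 2)) (fun x => x - sin x)) => //.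
- by rewrite cos0 expr0n /= mul0r subr0 subrr.
- by move=> y; apply: is_derive_eq; rewrite /GRing.scale /=; field.
- by move=> y; rewrite subr_ge0; exact: ler_sin_id.
Qed.

Lemma cos_ge x : 1 - x ^+ 2 / 2 <= cos x.
Proof. by rewrite -cos_norm -real_normK ?num_real// cos_ge_pos. Qed.

Lemma sin_ge_cube x : 0 <= x -> x - x ^+ 3 / 6 <= sin x.
Proof.
move=> x0; rewrite -subr_ge0.
apply: (@ge0_of_derive (fun x => sin x - (x - x ^+ 3 / 6))
          (fun x => cos x - (1 - x ^+ 2 / 2))) => //.
- by rewrite sin0 expr0n /= mul0r subr0 subrr.
- by move=> y; apply: is_derive_eq; rewrite /GRing.scale /=; field.
- by move=> y _; rewrite subr_ge0; exact: cos_ge.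
Qed.

Lemma sin_ge_third x : 0 <= x -> x <= 2 -> x / 3 <= sin x.
Proof.
move=> x0 x2; apply: le_trans (sin_ge_cube x0).
have : 0 <= x * (2 - x) * (2 + x) by rewrite !mulr_ge0 ?subr_ge0 ?addr_ge0.
by nra.
Qed.

Lemma pi_lt4 : pi < 4 :> R.
Proof. by have := @pihalf_lt2 R; lra. Qed.

Lemma cos_half x : cos x = 1 - 2 * sin (x / 2) ^+ 2.
Proof.
have -> : cos x = cos ((x / 2) *+ 2) by congr cos; rewrite mulr2n; field.
by rewrite cos_mulr2n cos2sin2; ring.
Qed.

(** Half-angle formula: as |x|/2 <= 2, [sin_ge_third] gives sin (|x|/2) >= |x|/6, hence the constant
    2/36. *)
Lemma cos_le_sq x : `|x| <= 4 -> cos x <= 1 - x ^+ 2 / 18.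
Proof.
move=> x4; rewrite -cos_norm -[x ^+ 2]real_normK ?num_real//.
move: (normr_ge0 x) x4; move: `|x| => y y0 y4.
rewrite cos_half lerD2l lerN2.
have : y / 2 / 3 <= sin (y / 2) by apply: sin_ge_third; lra.
have : 0 <= y / 2 / 3 by lra.
move: (sin _) => s; nra.
Qed.

Lemma ler_norm_sin x : `|sin x| <= `|x|.
Proof.
wlog x0 : x / 0 <= x => [H|].
  have [/H//|/ltW x0] := leP 0 x.
  by rewrite -normrN -sinN -[`|x|]normrN H// oppr_ge0.
rewrite (ger0_norm x0) ler_norml ler_sin_id// andbT.
have := ge0_of_derive (f := fun x => x + sin x) (df := fun x => 1 + cos x).
move=> /(_ _ _ _ x x0) H; rewrite -subr_ge0 opprK addrC H//.
by rewrite sin0 addr0.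
Qed.

Lemma cos_lipschitz x y : `|cos x - cos y| <= `|x - y|.
Proof.
have -> : cos x - cos y = - 2 * sin ((x + y) / 2) * sin ((x - y) / 2).
  have -> : cos x = cos ((x + y) / 2 + (x - y) / 2) by congr cos; field.
  have -> : cos y = cos ((x + y) / 2 - (x - y) / 2) by congr cos; field.
  by rewrite cosD cosB; ring.
rewrite !normrM normrN (ger0_norm (_ : 0 <= 2))//.
have -> : `|x - y| = 2 * 1 * `|(x - y) / 2|.
  by rewrite normrM (ger0_norm (_ : 0 <= 2^-1))//; field.
by rewrite ler_pM ?ler_norm_sin ?mulr_ge0// ler_pM// sin_max.
Qed.

Lemma cos_period x k : cos (x + 2 * pi * k%:R) = cos x.
Proof.
rewrite (_ : 2 * pi * k%:R = pi *+ 2 *+ k); first exact: periodicn (@cosD2pi R) k x.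
by rewrite -[_ *+ k]mulr_natr mulr2n; ring.
Qed.

Lemma cos_periodz x (k : int) : cos (x + 2 * pi * k%:~R) = cos x.
Proof.
case: k => k; first exact: cos_period.
by rewrite NegzE intrN mulrN -[in RHS](subrK (2 * pi * k.+1%:R) x) cos_period.
Qed.

Lemma cos_periodz_eq x y (k : int) : y = x + 2 * pi * k%:~R -> cos y = cos x.
Proof. by move=> ->; exact: cos_periodz. Qed.

(** Multiplied by 2 sin (x/2), each term becomes sin ((t + 1/2) x) - sin ((t - 1/2) x), and the sum
    telescopes. *)
Lemma dirichlet_kernel x s :
  2 * sin (x / 2) * \sum_(t < s) cos (t%:R * x) =
  sin ((s%:R - 2^-1) * x) + sin (x / 2).
Proof.
elim: s => [|s IH].
  rewrite big_ord0 mulr0 sub0r (_ : - 2^-1 * x = - (x / 2)); last by ring.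
  by rewrite sinN addNr.
rewrite big_ord_recr /= mulrDr IH -[s.+1%:R]natr1.
have -> : (s%:R + 1 - 2^-1) * x = s%:R * x + x / 2 by field.
have -> : (s%:R - 2^-1) * x = s%:R * x - x / 2 by field.
by rewrite sinB sinD; ring.
Qed.

(** The numerator of the kernel is at most 2 and its denominator at least |x|/3. *)
Lemma sum_cos_le x s : 0 < `|x| <= 4 -> \sum_(t < s) cos (t%:R * x) <= 6 / `|x|.
Proof.
move=> /andP[x0 x4].
have -> : \sum_(t < s) cos (t%:R * x) = \sum_(t < s) cos (t%:R * `|x|).
  by apply: eq_bigr => t _; rewrite -cos_norm normrM normr_nat.
move: {x}`|x| x0 x4 => x x0 x4.
have s0 : x / 2 / 3 <= sin (x / 2) by apply: sin_ge_third; lra.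
rewrite -(@ler_pM2l _ (2 * sin (x / 2))); last by lra.
rewrite dirichlet_kernel.
have : 2 <= 2 * sin (x / 2) * (6 / x).
  have -> : 2 * sin (x / 2) * (6 / x) = 12 * (sin (x / 2)) / x by field; rewrite gt_eqF.
  by rewrite ler_pdivlMr//; lra.
have := @sin_le1 R (x / 2); have := @sin_le1 R ((s%:R - 2^-1) * x); lra.
Qed.

End Trigonometry.

(** * Central binomial coefficients, products and exponentials *)

Lemma bin_le_center p a : ('C(p.*2, a) <= 'C(p.*2, p))%N.
Proof.
have up k : (k < p)%N -> ('C(p.*2, k) <= 'C(p.*2, k.+1))%N.
  move=> kp; rewrite -(@leq_pmul2l k.+1)// mul_bin_left leq_mul2r; apply/orP; right.
  by rewrite -addnn; lia.
have low d : (d <= p)%N -> ('C(p.*2, p - d) <= 'C(p.*2, p))%N.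
  elim: d => [|d IH] dp; first by rewrite subn0.
  by apply: leq_trans (IH _); rewrite ?(ltnW dp)// -(subnSK dp) up// ltn_subrL; lia.
have [ap|pa] := leqP a p; first by rewrite -(subKn ap) low// leq_subr.
have [a2|a2] := leqP a p.*2; last by rewrite bin_small.
rewrite -bin_sub// (_ : p.*2 - a = p - (a - p))%N; last by rewrite -addnn in a2 *; lia.
by rewrite low//; rewrite -addnn in a2; lia.
Qed.

(** This is C(2p, p) <= 4^p / sqrt (2p + 1), squared to stay in [nat]. The ratio of consecutive
    central coefficients reduces the induction to (2p + 1)(2p + 3) <= 4 (p + 1)^2. *)
Lemma central_bin_sq p : ('C(p.*2, p) ^ 2 * p.*2.+1 <= 16 ^ p)%N.
Proof.
elim: p => [|p IH]; first by rewrite bin0.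
have step : (p.+1 * 'C(p.+1.*2, p.+1) = 2 * p.*2.+1 * 'C(p.*2, p))%N.
  have e1 : (p.+1.*2 * 'C(p.*2.+1, p) = p.+1 * 'C(p.+1.*2, p.+1))%N.
    by rewrite -mul_bin_diag doubleS.
  have e2 : (p.*2.+1 * 'C(p.*2, p) = p.+1 * 'C(p.*2.+1, p))%N.
    by rewrite (mul_bin_down p.*2.+1 p); congr (_ * _)%N; rewrite -addnn; lia.
  by rewrite -e1 -muln2; nia.
rewrite [(16 ^ p.+1)%N]expnS -(@leq_pmul2l (p.+1 ^ 2)); last by rewrite expn_gt0.
apply: (@leq_trans (4 * p.*2.+1 * p.*2.+3 * ('C(p.*2, p) ^ 2 * p.*2.+1))%N).
  rewrite mulnA -expnMn step doubleS; move: 'C(p.*2, p) (p.*2) => C q.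
  by rewrite -!mulnn; nia.
apply: (@leq_trans (4 * p.*2.+1 * p.*2.+3 * 16 ^ p)%N); first by rewrite leq_mul2l IH orbT.
by rewrite mulnA leq_mul2r; apply/orP; right; rewrite -addnn -mulnn; lia.
Qed.

(** A binomial law with [N ^ 2] fair trials gives no value a probability above 1/N. Evenness of [N]
    makes [N ^ 2] of the form 2p. *)
Lemma bin_mul_le N a : ~~ odd N -> ('C(N ^ 2, a) * N <= 2 ^ (N ^ 2))%N.
Proof.
move=> oN; set p := (N ^ 2)./2.
have pE : (N ^ 2 = p.*2)%N by rewrite /p -[LHS]odd_double_half oddX (negbTE oN).
rewrite -leq_sqr expnMn -[X in (_ <= X)%N]expnM {1 3}pE.
apply: (@leq_trans ('C(p.*2, p) ^ 2 * p.*2.+1)%N).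
  by rewrite leq_mul// ?leq_sqr ?bin_le_center// pE.
by apply: leq_trans (central_bin_sq p) _; rewrite -muln2 -mulnA mulnC expnM.
Qed.

(** Induction on (1 - f)(1 + f + y) = 1 + y - f y - f^2. In [walk_gap] it bounds a product of
    cosines through the sum of their defects from 1. *)
Lemma prod_subr_le (R : realDomainType) (I : Type) (s : seq I) (F : I -> R) :
    (forall i, 0 <= F i <= 1) ->
  \prod_(i <- s) (1 - F i) * (1 + \sum_(i <- s) F i) <= 1.
Proof.
move=> F01; pose P := fun x y : R => [/\ 0 <= x, 0 <= y & x * (1 + y) <= 1].
suff [] : P (\prod_(i <- s) (1 - F i)) (\sum_(i <- s) F i) by [].
elim: s => [|i s [x0 y0 xy]]; rewrite ?big_nil ?big_cons.
  by split; rewrite ?ler01// addr0 mulr1.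
have /andP[f0 f1] := F01 i; split; rewrite ?addr_ge0 ?mulr_ge0 ?subr_ge0//.
move: xy x0 y0; move: (\prod_(_ <- s) _) (\sum_(_ <- s) _) => x y xy x0 y0.
have : 0 <= x * (F i * y + F i ^+ 2) by rewrite mulr_ge0 ?addr_ge0 ?mulr_ge0 ?sqr_ge0.
nra.
Qed.

Lemma expR_le_subr (R : realType) (t : R) : 0 <= t <= 2^-1 -> expR (- (2 * t)) <= 1 - t.
Proof.
move=> /andP[t0 t2]; rewrite expRN.
rewrite -[leRHS]invrK lef_pV2 ?posrE ?expR_gt0 ?invr_gt0; [|lra..].
apply: le_trans (expR_ge1Dx _); rewrite -div1r ler_pdivrMr; last lra.
have : 0 <= t * (1 - 2 * t) by rewrite mulr_ge0//; lra.
nra.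
Qed.

Lemma expR_ge_half_pow (R : realType) n : (2^-1 : R) ^+ n <= expR (- (n%:R / 2)).
Proof.
rewrite -mulrN expRM_natl lerXn2r ?nnegrE ?expR_ge0//.
by apply: le_trans (expR_ge1Dx _); lra.
Qed.

(** * Fourier analysis on (Z/m)^n *)

(** On the line, |F x - F y| is a nonnegative combination of cut metrics, one for each superlevel
    set of [F]. So a linear inequality between distances, with coefficients of any sign, need only
    be checked on cuts. *)
Lemma cut_metric_cone (R : realFieldType) (T : finType) (c : T -> T -> R) :
    (forall A : {set T},
       0 <= \sum_x \sum_y c x y * `|(x \in A)%:R - (y \in A)%:R|) ->
  forall F : T -> R, 0 <= \sum_x \sum_y c x y * `|F x - F y|.
Proof.
move=> cA F.
have pos (f : T -> R) : (forall x, 0 <= f x) -> 0 <= \sum_x \sum_y c x y * `|f x - f y|.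
  have [d] := ubnP #|[set x | 0 < f x]|.
  (* Subtract from f its minimum on its support, times the indicator of the support. *)
  elim: d => // d IH in f *; rewrite ltnS => fd f0; set A := [set x | 0 < f x] in fd.
  have [A0|/finset.set0Pn[x0 x0A]] := eqVneq A finset.set0.
    have fz x : f x = 0.
      apply/eqP; have := finset.in_set0 x; rewrite -A0 inE lt_neqAle f0 andbT eq_sym.
      by move=> /negbFE.
    by apply: sumr_ge0 => x _; apply: sumr_ge0 => y _; rewrite !fz subrr normr0 mulr0.
  case: (Order.TotalTheory.arg_minP f x0A) => x1 x1A0 fmin; have x1A : x1 \in A by [].
  pose g x := f x - f x1 * (x \in A)%:R.
  have fNA x : x \notin A -> f x = 0.
    by rewrite inE lt_neqAle f0 andbT negbK => /eqP <-.
  have g0 x : 0 <= g x.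
    rewrite /g; case: (boolP (x \in A)) => xA; last by rewrite mulr0 subr0.
    by rewrite mulr1 subr_ge0 fmin.
  have gA : (#|[set x | (0 < g x)%R]| < #|A|)%N.
    apply: proper_card; apply/properP; split.
      apply/fintype.subsetP => x; rewrite inE; apply: contraTT => xA.
      by rewrite /g fNA// (negbTE xA) mulr0 subr0 ltxx.
    by exists x1 => //; rewrite inE /g x1A mulr1 subrr ltxx.
  have -> : \sum_x \sum_y c x y * `|f x - f y| =
      f x1 * (\sum_x \sum_y c x y * `|(x \in A)%:R - (y \in A)%:R|) +
      \sum_x \sum_y c x y * `|g x - g y|.
    rewrite mulr_sumr -big_split /=; apply: eq_bigr => x _.
    rewrite mulr_sumr -big_split /=; apply: eq_bigr => y _.
    rewrite mulrCA -mulrDr; congr (_ * _); rewrite /g.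
    case: (boolP (x \in A)) => xA; case: (boolP (y \in A)) => yA.
    - by rewrite subrr normr0 mulr0 add0r; congr `|_|; ring.
    - rewrite (fNA y)// !mulr0 !subr0 !mulr1 normr1 mulr1 !ger0_norm ?subr_ge0 ?fmin//.
      by ring.
    - rewrite (fNA x)// !mulr0 !subr0 !mulr1 !sub0r !normrN normr1 mulr1.
      by rewrite !ger0_norm ?subr_ge0 ?fmin//; ring.
    - by rewrite !(fNA x, fNA y)// !mulr0 !subrr normr0 mulr0 addr0.
  by rewrite addr_ge0 ?mulr_ge0// IH// (leq_trans gA).
have [x0|T0] := pickP (@predT T); last first.
  by apply: sumr_ge0 => x; have := T0 x.
move=> _; pose mn := F [arg min_(x < x0) F x]%O.
have -> : \sum_x \sum_y c x y * `|F x - F y| =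
    \sum_x \sum_y c x y * `|(F x - mn) - (F y - mn)|.
  by apply: eq_bigr => x _; apply: eq_bigr => y _; congr (_ * `|_|); ring.
apply: (pos (fun x => F x - mn)) => x; rewrite subr_ge0 /mn.
by case: Order.TotalTheory.arg_minP => // y _; exact.
Qed.

Section FiniteFourier.
Context {R : realType} {n p : nat}.
Notation G := 'rV['I_p.+2]_n.
Implicit Types (x y : R) (a b : 'I_p.+2) (k g h : G) (A : {set G}).

(** The argument of exp(2 i pi a / m), with m = [p.+2]. It is additive only modulo 2 pi, so its
    algebra is stated under a cosine with a free phase [x]. *)
Definition angle a : R := 2 * pi * (a : nat)%:R / p.+2%:R.

Lemma cos_angleD x a b : cos (x + angle (a + b)) = cos (x + angle a + angle b).
Proof.
have qr : (a : nat)%:R + (b : nat)%:R =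
    ((a + b) %/ p.+2)%N%:R * p.+2%:R + ((a + b)%R : nat)%:R :> R.
  by rewrite -natrM -!natrD -divn_eq.
apply/esym/(@cos_periodz_eq _ _ _ (Posz ((a + b) %/ p.+2)%N)).
rewrite -[(Posz _)%:~R]/(((a + b) %/ p.+2)%N%:R).
rewrite -!addrA; congr (_ + _); rewrite /angle -mulrDl -mulrDr qr.
have m0 : p.+2%:R != 0 :> R by rewrite pnatr_eq0.
by move: p.+2%:R m0 => m m0; field.
Qed.

Lemma cos_angle0 x : cos (x + angle 0) = cos x.
Proof. by rewrite /angle /= mulr0 mul0r addr0. Qed.

Lemma cos_angleN x a : cos (x + angle (- a)) = cos (x - angle a).
Proof. by rewrite -[RHS]cos_angle0 -(subrr a) cos_angleD subrK. Qed.

Lemma cos_angleB x a b : cos (x + angle (a - b)) = cos (x + angle a - angle b).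
Proof. by rewrite cos_angleD cos_angleN. Qed.

Lemma cos_angleD0 a b : cos (angle (a + b)) = cos (angle a + angle b).
Proof. by rewrite -[angle _ in LHS]add0r cos_angleD add0r. Qed.

Lemma cos_angleB0 a b : cos (angle (a - b)) = cos (angle a - angle b).
Proof. by rewrite -[angle _ in LHS]add0r cos_angleB add0r. Qed.

Lemma cos_angle_int x (z : int) :
  cos (x + angle z%:~R) = cos (x + 2 * pi * z%:~R / p.+2%:R).
Proof.
have nat_case (i : nat) y : cos (y + angle i%:R) = cos (y + 2 * pi * i%:R / p.+2%:R).
  elim: i y => [|i IH] y; first by rewrite !cos_angle0.
  rewrite -natr1 cos_angleD addrAC IH -natr1; congr cos.
  rewrite /angle (_ : nat_of_ord (1 : 'I_p.+2) = 1%N)//.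
  by move: (p.+2%:R) => m; ring.
case: z => i; first exact: nat_case.
rewrite NegzE !intrN cos_angleN -cosN opprB addrC [_%:~R]/(_%:R) nat_case -cosN.
by congr cos; rewrite -[i.+1%:~R]/(i.+1%:R : R); ring.
Qed.

Lemma cos_angle_neq1 a : a != 0 -> cos (angle a) != 1.
Proof.
move=> a0; rewrite cos_half lt_eqF// gtrBl mulr_gt0// exprn_gt0//.
have m0 : 0 < p.+2%:R :> R by rewrite ltr0n.
have -> : angle a / 2 = pi * ((a : nat)%:R / p.+2%:R) 
    by rewrite /angle; move: p.+2%:R m0 => m m0; field; rewrite gt_eqF.
apply: sin_gt0_pi; rewrite mulr_gt0 ?pi_gt0 ?divr_gt0 ?ltr0n ?lt0n//=.
by rewrite gtr_pMr ?pi_gt0// ltr_pdivrMr// mul1r ltr_nat.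
Qed.

Definition dotm k g : 'I_p.+2 := \sum_j k 0 j * g 0 j.

Lemma dotmDl k k' g : dotm (k + k') g = dotm k g + dotm k' g.
Proof. by rewrite -big_split; apply: eq_bigr => j _; rewrite mxE mulrDl. Qed.

Lemma dotmC k g : dotm k g = dotm g k.
Proof. by apply: eq_bigr => j _; rewrite mulrC. Qed.

Lemma dotmDr k g h : dotm k (g + h) = dotm k g + dotm k h.
Proof. by rewrite dotmC dotmDl !(dotmC k). Qed.

Lemma dotm0l g : dotm 0 g = 0.
Proof. by apply: big1 => j _; rewrite mxE mul0r. Qed.

Lemma dotmNr k g : dotm k (- g) = - dotm k g.
Proof. by rewrite -sumrN; apply: eq_bigr => j _; rewrite mxE mulrN. Qed.

Lemma dotm_delta j g : dotm (delta_mx 0 j) g = g 0 j.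
Proof.
rewrite /dotm (bigD1 j)//= mxE !eqxx mul1r big1 ?addr0// => i ij.
by rewrite mxE (negbTE ij) mul0r.
Qed.

Lemma cos_addsub x y : cos (x + y) + cos (x - y) = 2 * cos y * cos x.
Proof. by rewrite cosB cosD; ring. Qed.

(* For g != 0 the sum is unchanged when x is shifted by +- the angle of some
   nonzero coordinate of g. *)
Lemma sum_cos_dotm x g :
  \sum_k cos (x + angle (dotm k g)) = (g == 0)%:R * (#|{: G}|%:R * cos x).
Proof.
have [->|g0] := eqVneq g 0.
  rewrite mul1r mulr_natl -sumr_const; apply: eq_bigr => k _.
  by rewrite dotmC dotm0l cos_angle0.
rewrite mul0r; have [j gj] : exists j, g 0 j != 0.
  apply/existsP; apply: contraNT g0; rewrite negb_exists => /forallP gz.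
  by apply/eqP/rowP => j; rewrite mxE; apply/eqP; rewrite -[_ == _]negbK gz.
pose S y := \sum_k cos (y + angle (dotm k g)).
have shift y : S y = S (y + angle (g 0 j)).
  rewrite /S (reindex_inj (addIr (delta_mx 0 j))) /=; apply: eq_bigr => k _.
  by rewrite dotmDl dotm_delta cos_angleD addrAC.
have : S (x + angle (g 0 j)) + S (x - angle (g 0 j)) = 2 * cos (angle (g 0 j)) * S x.
  rewrite /S -big_split mulr_sumr; apply: eq_bigr => k _ /=.
  by rewrite (addrAC x) (addrAC x (- _)) cos_addsub.
rewrite -shift (shift (x - _)) subrK -/(S x) => SE.
have : (1 - cos (angle (g 0 j))) * S x = 0 by move: SE; lra.
move/eqP; rewrite mulf_eq0 subr_eq0 eq_sym (negbTE (cos_angle_neq1 gj)) /=.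
by move/eqP.
Qed.

Lemma sum_cos_dotm0 g : \sum_k cos (angle (dotm k g)) = (g == 0)%:R * #|{: G}|%:R.
Proof.
have := sum_cos_dotm 0 g; rewrite cos0 mulr1 => <-.
by apply: eq_bigr => k _; rewrite add0r.
Qed.

(** The squared modulus of the sum of exp(i phi) over [P], in real form. *)
Definition energy (I : finType) (P : {pred I}) (phi : I -> R) : R :=
  (\sum_(i in P) cos (phi i)) ^+ 2 + (\sum_(i in P) sin (phi i)) ^+ 2.

Lemma energyE (I : finType) (P : {pred I}) (phi : I -> R) :
  energy P phi = \sum_(i in P) \sum_(j in P) cos (phi i - phi j).
Proof.
rewrite /energy !expr2 !mulr_suml -big_split; apply: eq_bigr => i _ /=.
by rewrite !mulr_sumr -big_split; apply: eq_bigr => j _; rewrite cosB.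
Qed.

Lemma energy_ge0 (I : finType) (P : {pred I}) (phi : I -> R) : 0 <= energy P phi.
Proof. by rewrite addr_ge0 ?sqr_ge0. Qed.

(** Expanding the square gives a double sum over [P], whose off-diagonal terms vanish when summed
    over the characters [k]. The phase [phi] allows any function of modulus 1 on [P]. *)
Lemma plancherel (P : {pred G}) (phi : G -> R) :
  \sum_k energy P (fun g => phi g + angle (dotm k g)) = #|{: G}|%:R * #|P|%:R.
Proof.
under eq_bigr do rewrite energyE.
rewrite exchange_big /= mulr_natr -sumr_const; apply: eq_bigr => g gP.
rewrite exchange_big /= (bigD1 g)//= [X in _ + X]big1 ?addr0 => [|h /andP[_ hg]].
  rewrite (eq_bigr (fun=> 1)) => [|k _]; last by rewrite subrr cos0.
  by rewrite sumr_const.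
rewrite (eq_bigr (fun k => cos (phi g - phi h + angle (dotm k (g - h))))) => [|k _].
  by rewrite sum_cos_dotm subr_eq0 eq_sym (negbTE hg) mul0r.
by rewrite dotmDr dotmNr cos_angleB; congr cos; ring.
Qed.

Lemma plancherel0 (P : {pred G}) :
  \sum_k energy P (fun g => angle (dotm k g)) = #|{: G}|%:R * #|P|%:R.
Proof.
rewrite -(plancherel P (fun=> 0)); apply: eq_bigr => k _.
by congr energy; apply/funext => g; rewrite add0r.
Qed.

Definition cut_change A h : R := \sum_x `|(x + h \in A)%:R - (x \in A)%:R|.

(** For a difference of indicators the L_1 norm is the squared L_2 norm. Plancherel gives the
    cardinality of [A], and the autocorrelation gives the cosine term. *)
Lemma cut_changeE A h : #|{: G}|%:R * cut_change A h =
  2 * \sum_k energy (mem A) (fun g => angle (dotm k g)) * (1 - cos (angle (dotm k h))).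
Proof.
have cutE : cut_change A h = 2 * (#|A|%:R - \sum_(x in A) (x + h \in A)%:R).
  have sA : \sum_x (x \in A)%:R = #|A|%:R :> R.
    by rewrite -sumr_const [RHS]big_mkcond; apply: eq_bigr => x _; case: ifP.
  have sAh : \sum_x (x + h \in A)%:R = #|A|%:R :> R.
    by rewrite -sA [RHS](reindex_inj (addIr h)).
  have sAAh : \sum_(x in A) (x + h \in A)%:R =
      \sum_x (x \in A)%:R * (x + h \in A)%:R :> R.
    by rewrite big_mkcond; apply: eq_bigr => x _; case: ifP; rewrite ?mul1r ?mul0r.
  transitivity (\sum_x ((x \in A)%:R + (x + h \in A)%:R -
      2 * ((x \in A)%:R * (x + h \in A)%:R)) : R).
    apply: eq_bigr => x _; case: (x \in A); case: (_ \in A);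
      rewrite /= ?subrr ?subr0 ?sub0r ?normrN ?normr0 ?normr1; by ring.
  by rewrite sumrB big_split /= sA sAh -mulr_sumr -sAAh; ring.
(* The autocorrelation of [A] at [h]. The product of two cosines splits into the shifts by [h] and
   by [- h], which contribute equally after a translation. *)
have corr : \sum_k energy (mem A) (fun g => angle (dotm k g)) * cos (angle (dotm k h)) =
    #|{: G}|%:R * \sum_(x in A) (x + h \in A)%:R.
  under eq_bigr do rewrite energyE mulr_suml.
  rewrite exchange_big mulr_sumr /=.
  transitivity (\sum_(g in A) \sum_(g' in A) #|{: G}|%:R / 2 *
      ((g' == g + h)%:R + (g == g' + h)%:R) : R).
    apply: eq_bigr => g _; under eq_bigr do rewrite mulr_suml.
    rewrite exchange_big /=; apply: eq_bigr => g' _.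
    transitivity (2^-1 * (\sum_k cos (angle (dotm k (g - g' + h))) +
                          \sum_k cos (angle (dotm k (g - g' - h))))).
      rewrite -big_split mulr_sumr; apply: eq_bigr => k _ /=.
      rewrite (dotmDr _ _ h) (dotmDr _ _ (- h)) (dotmNr _ h) cos_angleD0 cos_angleB0.
      by rewrite cos_addsub dotmDr dotmNr cos_angleB0; field.
    rewrite !sum_cos_dotm0 (_ : (g - g' + h == 0) = (g' == g + h)); last first.
      by rewrite addrAC subr_eq0 eq_sym.
    rewrite (_ : (g - g' - h == 0) = (g == g' + h)); last first.
      by rewrite -addrA -opprD subr_eq0.
    by ring.
  transitivity (\sum_(g in A) #|{: G}|%:R / 2 * ((g + h \in A)%:R + (g - h \in A)%:R) : R).
    have ind (z : G) : \sum_(g' in A) (g' == z)%:R = (z \in A)%:R :> R.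
      case: (boolP (z \in A)) => zA.
        by rewrite (bigD1 z)//= eqxx big1 ?addr0// => y /andP[_ /negbTE ->].
      by apply: big1 => y yA; case: eqP zA => // <-; rewrite yA.
    apply: eq_bigr => g _; rewrite -mulr_sumr big_split /= ind; congr (_ * (_ + _)).
    by rewrite -ind; apply: eq_bigr => y _; rewrite -subr_eq eq_sym.
  rewrite -mulr_sumr big_split /= -mulr_sumr.
  have -> : \sum_(g in A) (g - h \in A)%:R = \sum_(g in A) (g + h \in A)%:R :> R.
    rewrite big_mkcond [RHS]big_mkcond (reindex_inj (addIr h)) /=.
    apply: eq_bigr => y _; rewrite addrK.
    by case: ifP; case: ifP.
  by field.
rewrite cutE mulrCA; congr (2 * _); rewrite mulrBr -corr.
rewrite -[_ * #|A|%:R](plancherel0 (mem A)) -sumrB.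
by apply: eq_bigr => k _; rewrite mulrBr mulr1.
Qed.

(** Both sides expand in the energies of [A], which are nonnegative, so the comparison is termwise:
    at a nonzero [k] a uniform shift has mean gap exactly 1, the given steps have gap at least [c],
    and [k = 0] contributes nothing. *)
Lemma poincare_cut (I : Type) (s : seq I) (w : I -> R) (h : I -> G) (c : R) A :
    (forall k, k != 0 -> c <= \sum_(i <- s) w i * (1 - cos (angle (dotm k (h i))))) ->
  c * (\sum_g cut_change A g) <= #|{: G}|%:R * \sum_(i <- s) w i * cut_change A (h i).
Proof.
move=> gap; pose a k := energy (mem A) (fun g => angle (dotm k g)).
have G0 : 0 < #|{: G}|%:R :> R by rewrite ltr0n; apply/card_gt0P; exists 0.
have -> : #|{: G}|%:R * (\sum_(i <- s) w i * cut_change A (h i)) =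
    2 * \sum_k a k * \sum_(i <- s) w i * (1 - cos (angle (dotm k (h i)))).
  rewrite [LHS]mulr_sumr; under [LHS]eq_bigr do rewrite mulrCA cut_changeE.
  under [in RHS]eq_bigr do rewrite mulr_sumr.
  rewrite exchange_big mulr_sumr; apply: eq_bigr => i _ /=.
  rewrite mulrCA; congr (2 * _); rewrite mulr_sumr; apply: eq_bigr => k _.
  by rewrite mulrCA.
rewrite -(ler_pM2l G0) (mulrCA _ c).
have -> : #|{: G}|%:R * (\sum_g cut_change A g) =
    2 * \sum_k a k * ((k != 0)%:R * #|{: G}|%:R).
  rewrite [LHS]mulr_sumr; under [LHS]eq_bigr do rewrite cut_changeE.
  rewrite -mulr_sumr exchange_big; congr (2 * _); apply: eq_bigr => k _ /=.
  rewrite -mulr_sumr; congr (_ * _); rewrite sumrB sumr_const.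
  under [X in _ - X]eq_bigr do rewrite dotmC.
  by rewrite sum_cos_dotm0; case: eqP => _ /=; rewrite ?mul0r ?mul1r ?subr0 ?subrr.
rewrite !(mulrCA _ 2) ler_pM2l// [leLHS]mulr_sumr [leRHS]mulr_sumr; apply: ler_sum => k _.
have [->|k0] := eqVneq k 0.
  rewrite mul0r !mulr0 [X in _ * (_ * X)]big1 ?mulr0// => i _.
  by rewrite dotm0l /angle mulr0 mul0r cos0 subrr mulr0.
rewrite mul1r (mulrC (a k)) mulrCA ler_pM2l// mulrC ler_wpM2l ?energy_ge0//.
exact: gap.
Qed.

Lemma poincare (I : Type) (s : seq I) (w : I -> R) (h : I -> G) (c : R) (F : G -> R) :
    (forall k, k != 0 -> c <= \sum_(i <- s) w i * (1 - cos (angle (dotm k (h i))))) ->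
  c * (\sum_(x : G) \sum_(y : G) `|F x - F y|) <=
  #|{: G}|%:R * \sum_(i <- s) w i * \sum_(x : G) `|F (x + h i) - F x|.
Proof.
move=> gap.
(* The difference of the two sides is one linear form in the distances, with coefficients [C] of
   both signs, as [cut_metric_cone] allows. *)
pose C (x y : G) := #|{: G}|%:R * (\sum_(i <- s) w i * (x == y + h i)%:R) - c.
have CE (f : G -> R) : \sum_(x : G) \sum_(y : G) C x y * `|f x - f y| =
    #|{: G}|%:R * (\sum_(i <- s) w i * \sum_(x : G) `|f (x + h i) - f x|) -
    c * \sum_(x : G) \sum_(y : G) `|f x - f y|.
  rewrite (mulr_sumr _ _ _ c) [X in X - _](_ : _ =
    \sum_(x : G) \sum_(y : G) #|{: G}|%:R * (\sum_(i <- s) w i * (x == y + h i)%:R) * `|f x - f y|).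
    rewrite -sumrB; apply: eq_bigr => x _; rewrite mulr_sumr -sumrB.
    by apply: eq_bigr => y _; rewrite mulrBl.
  rewrite [RHS]exchange_big mulr_sumr.
  under [RHS]eq_bigr do under eq_bigr do rewrite -mulrA mulr_suml mulr_sumr.
  under [RHS]eq_bigr do rewrite exchange_big.
  rewrite exchange_big; apply: eq_bigr => i _; rewrite /= !mulr_sumr; apply: eq_bigr => y _.
  rewrite (bigD1 (y + h i))//= eqxx big1 => [|x /negbTE ->]; last by rewrite !(mulr0,mul0r).
  by rewrite addr0 mulr1.
rewrite -subr_ge0 -CE; apply: cut_metric_cone => A; rewrite CE subr_ge0.
have -> : \sum_(x : G) \sum_(y : G) `|(x \in A)%:R - (y \in A)%:R| = \sum_g cut_change A g :> R.
  rewrite [RHS]exchange_big [LHS]exchange_big; apply: eq_bigr => x _ /=.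
  by rewrite (reindex_inj (addrI x)).
exact: poincare_cut.
Qed.

End FiniteFourier.

(** * Torsion points of the torus and their characters *)

Section TorusPoints.
Context {R : realType} {n p : nat} (L : lattice R n) (B : 'M[R]_n).
Hypothesis Bunit : B \in unitmx.
Hypothesis LB : lattice_set L =
  [set (map_mx intr z *m B)%R | z in [set: 'rV[int]_n]%classic]%classic.
Notation G := 'rV['I_p.+2]_n.
Implicit Types (z : 'rV[int]_n) (k g : G).

Definition dual_vec (z : 'rV[int]_n) : 'rV[R]_n := map_mx intr z *m invmx B^T.

Lemma dotp_dual_vec (c : 'rV[R]_n) z : dotp (c *m B) (dual_vec z) = \sum_j c 0 j * (z 0 j)%:~R.
Proof.
rewrite dotpE /dual_vec trmx_mul -trmx_inv trmxK mulmxA mulmxK// mxE.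
by apply: eq_bigr => j _; rewrite !mxE.
Qed.

Lemma dual_vec_dual z : dual_set L (dual_vec z).
Proof.
move=> y; rewrite LB => -[w _ <-]; rewrite dotpC dotp_dual_vec.
by apply: rpred_sum => j _; rewrite mxE rpredM// intr_int.
Qed.

Lemma dual_vecP x : dual_set L x -> exists z, x = dual_vec z.
Proof.
move=> xL; exists (\row_j Num.floor ((x *m B^T) 0 j)).
rewrite /dual_vec -[LHS](mulmxK (_ : B^T \in unitmx)) ?unitmx_tr//; congr (_ *m _).
apply/rowP => j; have E : (x *m B^T) 0 j = dotp x (row j B).
  by rewrite mxE; apply: eq_bigr => k _; rewrite !mxE.
rewrite [RHS]mxE [X in X%:~R]mxE E; apply/esym/eqP.
rewrite -[_ == _]intrEfloor; apply: xL; rewrite LB; exists (delta_mx 0 j) => //.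
by rewrite map_delta_mx -rowE.
Qed.

Lemma dual_vec_eq0 z : dual_vec z = 0 -> z = 0.
Proof.
move=> z0; have /(congr1 (fun v => v *m B^T)) := z0.
rewrite /dual_vec mulmxKV ?unitmx_tr// mul0mx => /rowP zz; apply/rowP => j.
by have := zz j; rewrite !mxE => /eqP; rewrite intr_eq0 => /eqP.
Qed.

Definition pointZ z : 'rV[R]_n := (p.+2%:R^-1 *: map_mx intr z) *m B.

(* G = (Z/m)^n with m = p.+2 stands for the m-torsion points of the torus: g is
   sent to g/m in the basis B, and the class of z in int^n to z/m modulo L. *)
Definition gpoint g : 'rV[R]_n := pointZ (map_mx (fun a : 'I_p.+2 => Posz (a : nat)) g).

Definition reduce z : G := map_mx (intr : int -> 'I_p.+2) z.

Lemma pointZD z z' : pointZ (z + z') = pointZ z + pointZ z'.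
Proof. by rewrite /pointZ map_mxD scalerDr mulmxDl. Qed.

Lemma pointZN z : pointZ (- z) = - pointZ z.
Proof. by rewrite /pointZ map_mxN scalerN mulNmx. Qed.

Lemma reduceD z z' : reduce (z + z') = reduce z + reduce z'.
Proof. by rewrite /reduce map_mxD. Qed.

Lemma reduce_lift g : reduce (map_mx (fun a : 'I_p.+2 => Posz (a : nat)) g) = g.
Proof.
by apply/rowP => j; rewrite !mxE -[_%:~R]/((g 0 j : nat)%:R) natr_Zp.
Qed.

Lemma Zp_int (a : int) : exists q : int, a = q * p.+2%:Z + Posz ((a%:~R : 'I_p.+2) : nat).
Proof.
exists (a %/ p.+2%:Z)%Z; rewrite [LHS](divz_eq a p.+2); congr (_ + _).
have m0 : 0 <= (a %% p.+2)%Z by rewrite modz_ge0.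
have m1 : (a %% p.+2)%Z < p.+2 by rewrite ltz_pmod.
rewrite [in RHS](divz_eq a p.+2); move: m0 m1; case: (a %% p.+2)%Z => // r _ rp.
rewrite intrD intrM (_ : p.+2%:~R = 0 :> 'I_p.+2) ?mulr0 ?add0r; last first.
  by rewrite -[_%:~R]/(p.+2%:R) Zp_nat; apply/val_inj; rewrite /= modnn.
by rewrite -[r%:~R]/(r%:R) Zp_nat /= modn_small.
Qed.

Lemma reduce_eq z z' : reduce z = reduce z' -> lattice_set L (pointZ z - pointZ z').
Proof.
move=> zz'; rewrite -pointZN -pointZD LB.
have [q qE] : exists q : 'rV[int]_n, z - z' = q *+ p.+2.
  have Q j : exists q : int, (z - z') 0 j = q * p.+2%:Z.
    have [q ->] := Zp_int ((z - z') 0 j); exists q; rewrite !mxE intrB.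
    by have /rowP/(_ j) := zz'; rewrite !mxE => ->; rewrite subrr addr0.
  have [q qE] := boolp.choice Q; exists (\row_j q j); apply/rowP => j.
  by rewrite qE mulmxnE mxE -mulr_natr natz.
exists q => //; rewrite qE /pointZ.
have -> : map_mx intr (q *+ p.+2) = p.+2%:R *: map_mx intr q :> 'rV[R]_n.
  by apply/rowP => j; rewrite mxE mulmxnE rmorphMn !mxE mulr_natl.
by rewrite scalerA mulVf ?scale1r// pnatr_eq0.
Qed.

Lemma gpoint_add g z : lattice_set L (gpoint (g + reduce z) - (gpoint g + pointZ z)).
Proof. by rewrite -pointZD; apply: reduce_eq; rewrite reduceD !reduce_lift. Qed.

Lemma dotm_reduce z z' :
  dotm (reduce z) (reduce z') = (\sum_j z 0 j * z' 0 j)%:~R.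
Proof. by rewrite rmorph_sum; apply: eq_bigr => j _; rewrite !mxE rmorphM. Qed.

Lemma cos_dotm_reduce (x : R) z z' :
  cos (x + angle (dotm (reduce z) (reduce z'))) =
  cos (x + 2 * pi * (\sum_j z 0 j * z' 0 j)%:~R / p.+2%:R).
Proof. by rewrite dotm_reduce cos_angle_int. Qed.

(** The dual vector pairs with g/m as the character [reduce z] does with [g], and with [y] to an
    integer. So every representative of a torsion point gives the same cosine. *)
Lemma cos_dual_vec (x : R) g y z : lattice_set L y ->
  cos (x + 2 * pi * dotp (gpoint g - y) (dual_vec z)) = cos (x + angle (dotm (reduce z) g)).
Proof.
move=> Ly; have : dotp y (dual_vec z) \is a Num.int by rewrite dotpC dual_vec_dual.
move=> /intrP[q qE]; rewrite dotpDl -scaleN1r dotpZl qE.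
rewrite -{2}(reduce_lift g) cos_dotm_reduce /gpoint /pointZ dotp_dual_vec.
apply: (@cos_periodz_eq _ _ _ (- q)); rewrite intrN mulN1r mulrDr addrA; congr (_ + _ + _).
rewrite rmorph_sum -[RHS]mulrA mulr_suml; congr (_ * _); apply: eq_bigr => j _.
by rewrite !mxE rmorphM /=; ring.
Qed.

End TorusPoints.

Arguments pointZ {R n} p B z.
Arguments reduce {n} p z.

(** * A random step on the torus *)

Section Walk.
Context {R : realType} {V : zmodType}.
Implicit Types vs : seq V.

(* All sums +-v_1 ... +-v_l, one for each choice of signs. *)
Fixpoint walk vs : seq V :=
  if vs is v :: vs' then [seq x + v | x <- walk vs'] ++ [seq x - v | x <- walk vs']
  else [:: 0].

Lemma size_walk vs : size (walk vs) = (2 ^ size vs)%N.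
Proof. by elim: vs => //= v vs IH; rewrite size_cat !size_map IH addnn expnS mul2n. Qed.

Lemma morphB_D (W : zmodType) (f : V -> W) : {morph f : x y / x - y} ->
  f 0 = 0 /\ {morph f : x y / x + y}.
Proof.
move=> fB; have f0 : f 0 = 0 by rewrite -(subrr 0) fB subrr.
by split=> // x y; rewrite -[y in LHS]opprK -[- y]sub0r !fB f0 sub0r opprK.
Qed.

(** Signs are independent: averaging over one of them replaces cos (a + b) and cos (a - b) by cos a
    cos b. *)
Lemma sum_walk_cos (l : V -> R) vs : {morph l : x y / x - y} ->
  \sum_(x <- walk vs) cos (l x) = 2 ^+ size vs * \prod_(v <- vs) cos (l v).
Proof.
move=> lB; have [l0 lD] := morphB_D lB.
elim: vs => [|v vs IH] /=; first by rewrite big_seq1 big_nil l0 cos0 mulr1.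
rewrite big_cat !big_map /= -big_split big_cons /= exprS.
under eq_bigr do rewrite lD lB cos_addsub.
by rewrite -mulr_sumr IH; ring.
Qed.

(** Parallelogram law: the cross terms cancel over the signs. *)
Lemma sum_walk_dotp n (f : V -> 'rV[R]_n) vs : {morph f : x y / x - y} ->
  \sum_(x <- walk vs) dotp (f x) (f x) = 2 ^+ size vs * \sum_(v <- vs) dotp (f v) (f v).
Proof.
move=> fB; have [f0 fD] := morphB_D fB.
elim: vs => [|v vs IH] /=.
  rewrite big_seq1 big_nil f0 mulr0.
  by apply: big1 => i _; rewrite mxE mul0r.
rewrite big_cat !big_map /= -big_split big_cons /= exprS.
have par (u w : 'rV[R]_n) :
    dotp (u + w) (u + w) + dotp (u - w) (u - w) = 2 * dotp u u + 2 * dotp w w.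
  rewrite -scaleN1r !(dotpDl, dotpC _ (_ + _), dotpZl, dotpC _ (_ *: _)).
  by rewrite (dotpC w u); ring.
under eq_bigr do rewrite fD fB par.
rewrite big_split /= -mulr_sumr IH big_const_seq count_predT size_walk iter_addr_0.
by rewrite -[_ *+ (2 ^ _)]mulr_natr natrX; ring.
Qed.

End Walk.

Section EuclideanFacts.
Context {R : realType} {n : nat}.
Implicit Types u v : 'rV[R]_n.

Lemma dotpBl u v w : dotp (u - v) w = dotp u w - dotp v w.
Proof. by rewrite -scaleN1r dotpDl dotpZl mulN1r. Qed.

Lemma sqr_enorm u : enorm u ^+ 2 = dotp u u.
Proof. by rewrite sqr_sqrtr ?dotp_ge0. Qed.

Lemma enormZ (a : R) u : enorm (a *: u) = `|a| * enorm u.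
Proof.
apply/eqP; rewrite -(@eqrXn2 _ 2) ?mulr_ge0 ?enorm_ge0// exprMn !sqr_enorm.
by rewrite dotpZl dotpC dotpZl mulrA real_normK ?num_real// expr2.
Qed.

Lemma enorm_sum (I : Type) (s : seq I) (F : I -> 'rV[R]_n) :
  enorm (\sum_(i <- s) F i) <= \sum_(i <- s) enorm (F i).
Proof.
elim: s => [|i s IH]; rewrite ?big_nil ?enorm0// !big_cons.
by rewrite (le_trans (enormD _ _))// lerD2l.
Qed.

Lemma enorm_delta i : enorm (delta_mx 0 i : 'rV[R]_n) = 1.
Proof.
rewrite /enorm /dotp (bigD1 i)//= mxE !eqxx mulr1 big1 ?addr0 ?sqrtr1// => j ji.
by rewrite mxE (negbTE ji) andbF mul0r.
Qed.

Lemma dotp_enorm_le u v : `|dotp u v| <= enorm u * enorm v.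
Proof.
rewrite -(@ler_pXn2r _ 2) ?nnegrE ?mulr_ge0 ?enorm_ge0//.
by rewrite real_normK ?num_real// exprMn !sqr_enorm dotp_cauchy.
Qed.

Lemma sum_norm_le_enorm u : \sum_i `|u 0 i| <= Num.sqrt n%:R * enorm u.
Proof.
pose v : 'rV[R]_n := \row_i `|u 0 i|; pose w : 'rV[R]_n := \row_i 1.
have -> : \sum_i `|u 0 i| = dotp w v.
  by apply: eq_bigr => i _; rewrite !mxE mul1r.
apply: le_trans (ler_norm _) (le_trans (dotp_enorm_le _ _) _).
rewrite ler_pM ?enorm_ge0//.
  rewrite /enorm; suff -> : dotp w w = n%:R by [].
  by rewrite /dotp (eq_bigr (fun=> 1)) ?sumr_const ?card_ord// => i _; rewrite !mxE mulr1.
rewrite /enorm; suff -> : dotp v v = dotp u u by [].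
by apply: eq_bigr => i _; rewrite !mxE -normrM -expr2 ger0_norm ?sqr_ge0.
Qed.

Lemma enorm_le_sup u (c : R) : (forall i, `|u 0 i| <= c) -> enorm u <= Num.sqrt n%:R * c.
Proof.
move=> uc; case: (posnP n) => [n0|n_gt0].
  rewrite /enorm /dotp big1 ?sqrtr0 => [|i]; last first.
    by have := ltn_ord i; rewrite [X in (_ < X)%N]n0.
  by rewrite n0 sqrtr0 mul0r.
have c0 : 0 <= c by apply: le_trans (uc (Ordinal n_gt0)).
rewrite -(@ler_pXn2r _ 2) ?nnegrE ?mulr_ge0 ?enorm_ge0// ?sqrtr_ge0//.
rewrite exprMn sqr_enorm sqr_sqrtr// mulr_natl -[n in leRHS]card_ord -sumr_const.
apply: ler_sum => i _; rewrite -expr2 -real_normK ?num_real//.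
by rewrite lerXn2r ?nnegrE.
Qed.

End EuclideanFacts.

Definition symrep p (a : 'I_p.+2) : int :=
  if (a.*2 <= p.+2)%N then Posz a else Posz a - p.+2%:Z.

Lemma symrepK p (a : 'I_p.+2) : (symrep a)%:~R = a.
Proof.
rewrite /symrep; case: ifP => _; rewrite ?intrB -[(Posz a)%:~R]/((a : nat)%:R) natr_Zp//.
rewrite (_ : p.+2%:~R = 0 :> 'I_p.+2) ?subr0//.
by rewrite -[_%:~R]/(p.+2%:R) Zp_nat; apply/val_inj; rewrite /= modnn.
Qed.

Lemma symrep_le p (a : 'I_p.+2) : `|symrep a| * 2 <= p.+2%:Z.
Proof.
have := ltn_ord a; rewrite /symrep -muln2; move: (nat_of_ord a) => x.
by case: ifP; lia.
Qed.

Section RealEstimates.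
Context {R : realType}.
Implicit Types a b e x y : R.

Lemma norm_le_eighth a b e :
  `|a - b| <= e -> e <= 16^-1 -> `|b| <= 16^-1 -> `|a| <= 8^-1.
Proof.
move=> ab e16 b16; rewrite -(subrK b a) (le_trans (ler_normD _ _))//.
by move: `|a - b| `|b| ab b16 => u v; lra.
Qed.

Lemma norm_2pi_le1 x : `|x| <= 8^-1 -> `|2 * pi * x| <= 1.
Proof.
move=> x8; rewrite !normrM (ger0_norm (_ : 0 <= 2))// (ger0_norm (@pi_ge0 R)).
by have := @pi_lt4 R; have := @pi_ge0 R; move: `|x| (normr_ge0 x) x8 => y; nra.
Qed.

Lemma sqr_error_le (N n e : R) : 1 <= N -> 1 <= n -> 0 <= e -> N * n * e <= 16^-1 ->
  n * e ^+ 2 * N ^+ 2 <= 8^-1.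
Proof.
move=> N1 n1 e0 Nne; have Ne0 : 0 <= N * e by rewrite mulr_ge0// (le_trans ler01).
have Ne : N * e <= N * n * e by rewrite mulrAC ler_peMr.
have -> : n * e ^+ 2 * N ^+ 2 = (N * n * e) * (N * e) by ring.
by move: (N * n * e) (N * e) Nne Ne Ne0 => u v; nra.
Qed.

Lemma sqr_half_le x y e : `|x - y| <= e -> y ^+ 2 / 2 - e ^+ 2 <= x ^+ 2.
Proof.
move=> xy; have : (x - y) ^+ 2 <= e ^+ 2.
  rewrite -[leLHS]real_normK ?num_real// lerXn2r ?nnegrE//.
  exact: le_trans (normr_ge0 _) xy.
by have := sqr_ge0 (2 * x - y); nra.
Qed.

Lemma sqr_le_cos x : `|2 * pi * x| <= 1 -> 16 / 18 * x ^+ 2 <= 1 - cos (2 * pi * x).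
Proof.
move=> x1; have : cos (2 * pi * x) <= 1 - (2 * pi * x) ^+ 2 / 18.
  by apply: cos_le_sq; apply: le_trans x1 _; rewrite ler1n.
have := @pi_ge2 R; move: pi (cos _) => P C P2.
rewrite (_ : (2 * P * x) ^+ 2 = 4 * P ^+ 2 * x ^+ 2); last by ring.
move: (x ^+ 2) (sqr_ge0 x) => X X0.
have : 4 * X <= P ^+ 2 * X by rewrite ler_wpM2r//; nra.
move: (P ^+ 2) => Q; nra.
Qed.

Lemma cos_ge0_small x : `|x| <= 1 -> 0 <= cos x.
Proof.
move=> x1; apply: le_trans (cos_ge _).
have : x ^+ 2 <= 1 by rewrite -[leLHS]real_normK ?num_real// expr_le1.
by lra.
Qed.

Lemma one_sub_ge_quarter x y : 1 / 3 <= y -> 0 <= x -> x * (1 + y) <= 1 -> 4^-1 <= 1 - x.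
Proof. by nra. Qed.

End RealEstimates.

(** * Length and spectral gap of the random walk *)

Section SpectralGap.
Context {R : realType} {n : nat} (B : 'M[R]_n).
Hypotheses (Bunit : B \in unitmx) (n_gt0 : (0 < n)%N).
Hypothesis dual_ge1 : forall z, z != 0 -> 1 <= enorm (dual_vec B z).

(** [beta] turns a bound on coordinates in the basis [B] into one on the norm; [gamma] bounds the
    coordinates of dual vectors with bounded coefficients. *)
Let beta : R := \sum_j enorm (row j B).
Let gamma : R := \sum_i \sum_j `|invmx B i j|.

Lemma enorm_mulmx (c : 'rV[R]_n) (a : R) :
  (forall j, `|c 0 j| <= a) -> enorm (c *m B) <= a * beta.
Proof.
move=> ca; rewrite mulmx_sum_row mulr_sumr; apply: le_trans (enorm_sum _ _) _.
by apply: ler_sum => j _; rewrite enormZ ler_wpM2r ?enorm_ge0.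
Qed.

(** Each coordinate direction is used [N ^ 2] times with a step of about 1/N. [K0] limits the
    frequencies left to the walk: [N_gamma] makes their phases small at each step, while [p_beta]
    and [p_N] control the rounding to torsion points. *)
Variables (N K0 p : nat).
Hypotheses (K0_gt0 : (0 < K0)%N) (N_gt0 : (0 < N)%N).
Hypotheses (K0_beta : 3 * beta <= K0%:R) (N_gamma : 16 * K0%:R * gamma <= N%:R).
Hypotheses (p_beta : N%:R * beta <= p.+2%:R) (p_N : (16 * N * n ^ 2 * K0 <= p.+2)%N).

Let m : R := p.+2%:R.
Let m_gt0 : 0 < m. Proof. by rewrite /m ltr0n. Qed.
Let m_inv_ge0 : 0 <= m^-1. Proof. by rewrite invr_ge0 ltW. Qed.
Let N0 : 0 < N%:R :> R. Proof. by rewrite ltr0n. Qed.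
Let N_inv_ge0 : 0 <= N%:R^-1 :> R. Proof. by rewrite invr_ge0 ltW. Qed.
Let K00 : 0 < K0%:R :> R. Proof. by rewrite ltr0n. Qed.

(* The i-th coordinate vector divided by N, rounded to the points of order m: in
   the basis B, its coordinates are floor (m / N * invmx B i j) / m. *)
Definition grid_step (i : 'I_n) : 'rV[int]_n :=
  \row_j Num.floor (m / N%:R * invmx B i j).

Let steps := [seq grid_step x.1 | x : 'I_n * 'I_(N ^ 2)].

Let big_steps (idx : R) (op : Monoid.com_law idx) (F : 'rV[int]_n -> R) :
  \big[op/idx]_(v <- steps) F v = \big[op/idx]_(i < n) \big[op/idx]_(j < N ^ 2) F (grid_step i).
Proof. by rewrite big_image /= (pair_bigA _ (fun i _ => F (grid_step i))). Qed.

Lemma grid_step_error i j :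
  `|(grid_step i 0 j)%:~R - m / N%:R * invmx B i j| <= 1.
Proof.
rewrite mxE; set x := _ * _; have /andP[] := real_floor_itv (num_real x).
rewrite intrD => x1 x2; rewrite ler_norml; apply/andP; split; lra.
Qed.

Lemma enorm_grid_step i : enorm (pointZ p B (grid_step i)) <= 2 / N%:R.
Proof.
pose c : 'rV[R]_n := \row_j (m^-1 * ((grid_step i 0 j)%:~R - m / N%:R * invmx B i j)).
have -> : pointZ p B (grid_step i) = N%:R^-1 *: delta_mx 0 i + c *m B.
  rewrite /pointZ (_ : _ *: _ = c + N%:R^-1 *: row i (invmx B)).
    rewrite mulmxDl -scalemxAl -row_mul mulVmx// rowE mulmx1 addrC.
  by [].
  apply/rowP => j; rewrite !mxE -/m; set f := (Num.floor _)%:~R.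
  by move: m_gt0 => m0; field; rewrite !gt_eqF.
apply: le_trans (enormD _ _) _; rewrite enormZ enorm_delta mulr1 (ger0_norm N_inv_ge0).
have -> : 2 / N%:R = N%:R^-1 + N%:R^-1 :> R by ring.
rewrite lerD2l; apply: le_trans (_ : m^-1 * beta <= _).
  apply: enorm_mulmx => j; rewrite mxE normrM (ger0_norm m_inv_ge0).
  by rewrite ler_piMr// grid_step_error.
rewrite mulrC ler_pdivrMr// -ler_pdivrMl ?invr_gt0// invrK//.
Qed.

(** The mean squared length is at most n N^2 (2/N)^2 = 4n. The mean length follows by the inequality
    of means with a = 2 sqrt n. *)
Lemma mean_walk_enorm :
  \sum_(z <- walk steps) 2 ^- size steps * enorm (pointZ p B z) <= 2 * Num.sqrt n%:R.
Proof.
have l2 : 0 < 2 ^+ size steps :> R by rewrite exprn_gt0.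
have n0 : 0 < Num.sqrt n%:R :> R by rewrite sqrtr_gt0 ltr0n.
pose a : R := 2 * Num.sqrt n%:R; have a0 : 0 < a by rewrite mulr_gt0.
have amgm (u : 'rV[R]_n) : enorm u <= 2^-1 * (dotp u u / a + a).
  rewrite -sqr_enorm -subr_ge0.
  have -> : 2^-1 * (enorm u ^+ 2 / a + a) - enorm u = (enorm u - a) ^+ 2 / (2 * a).
    by field; rewrite gt_eqF.
  by rewrite divr_ge0 ?sqr_ge0// mulr_ge0// ltW.
rewrite -mulr_sumr ler_pdivrMl//.
apply: le_trans (ler_sum _ (fun z _ => amgm (pointZ p B z))) _.
rewrite -mulr_sumr big_split /= big_const_seq count_predT size_walk iter_addr_0.
rewrite -mulr_suml -[X in _ + X]mulr_natr natrX.
rewrite (@sum_walk_dotp _ _ _ (pointZ p B)); last first.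
  by move=> x y; rewrite pointZD pointZN.
rewrite big_steps; set S := \sum_(i < n) _.
have S4 : S <= a ^+ 2.
  have -> : a ^+ 2 = \sum_(i < n) 4.
    by rewrite sumr_const card_ord /a exprMn sqr_sqrtr ?ler0n// -[RHS]mulr_natr; ring.
  apply: ler_sum => i _; rewrite sumr_const card_ord -[leLHS]mulr_natr natrX -sqr_enorm -exprMn.
  rewrite (_ : 4 = 2 ^+ 2); last by ring.
  rewrite lerXn2r ?nnegrE ?mulr_ge0 ?enorm_ge0//.
  by rewrite -ler_pdivlMr// enorm_grid_step.
have : S / a <= a by rewrite ler_pdivrMr// -expr2.
move: (2 ^+ _) l2 => l l0 Sa; rewrite -/a.
have -> : 2^-1 * (l * S / a + a * l) = l * (2^-1 * (S / a + a)) by ring.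
rewrite ler_pM2l//; lra.
Qed.

Lemma pairing_grid_step (k : 'rV[int]_n) i : (forall j, `|k 0 j| <= K0%:Z) ->
  `|(\sum_j k 0 j * grid_step i 0 j)%:~R / m - dual_vec B k 0 i / N%:R| <= n%:R * K0%:R / m.
Proof.
move=> kK.
have -> : (\sum_j k 0 j * grid_step i 0 j)%:~R / m - dual_vec B k 0 i / N%:R =
    m^-1 * \sum_j (k 0 j)%:~R * ((grid_step i 0 j)%:~R - m / N%:R * invmx B i j).
  rewrite rmorph_sum /dual_vec mxE !mulr_suml mulr_sumr -sumrB; apply: eq_bigr => j _.
  rewrite rmorphM -trmx_inv !mxE /=; set f := (Num.floor _)%:~R.
  by field; rewrite !gt_eqF.
rewrite normrM (ger0_norm m_inv_ge0) mulrC ler_pM2r ?invr_gt0//.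
apply: le_trans (ler_norm_sum _ _ _) _.
rewrite mulr_natl -[n in leRHS]card_ord -sumr_const; apply: ler_sum => j _.
rewrite normrM -[leRHS]mulr1 ler_pM// ?grid_step_error//.
by rewrite -intr_norm -[K0%:R]/(K0%:Z%:~R) ler_int.
Qed.

(** The mean cosine is a product of cosines of single phases, each repeated [N ^ 2] times. The
    phases are close to the coordinates of a dual vector divided by N; as this vector has norm at
    least 1, the defects of the cosines add up to 1/3 and the product is at most 3/4. *)
Lemma walk_gap (k : 'rV[int]_n) : k != 0 -> (forall j, `|k 0 j| <= K0%:Z) ->
  (4^-1 : R) <= \sum_(z <- walk steps) 2 ^- size steps *
    (1 - cos (angle (dotm (reduce p k) (reduce p z)))).
Proof.
move=> k0 kK; have l2 : 0 < 2 ^+ size steps :> R by rewrite exprn_gt0.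
pose l (z : 'rV[int]_n) : R := 2 * pi * ((\sum_j k 0 j * z 0 j)%:~R / m).
have lB : {morph l : x y / x - y}.
  move=> x y; rewrite /l -mulrBr -mulrBl -rmorphB -sumrB; congr (_ * (_%:~R / _)).
  by apply: eq_bigr => j _; rewrite !mxE mulrBr.
rewrite -mulr_sumr sumrB big_const_seq count_predT size_walk iter_addr_0.
have -> : \sum_(z <- walk steps) cos (angle (dotm (reduce p k) (reduce p z))) =
    \sum_(z <- walk steps) cos (l z).
  apply: eq_bigr => z _; rewrite -[angle _]add0r cos_dotm_reduce add0r.
  by rewrite /l mulrA.
rewrite sum_walk_cos// natrX mulrBr mulrA mulVf ?gt_eqF// mul1r.
rewrite (big_steps _ (fun z => cos (l z))).
pose x (i : 'I_n) : R := (\sum_j k 0 j * grid_step i 0 j)%:~R / m.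
have n0 : 0 < n%:R :> R by rewrite ltr0n.
have n1 : 1 <= n%:R :> R by rewrite ler1n.
have N1 : 1 <= N%:R :> R by rewrite ler1n.
pose e : R := n%:R * K0%:R / m.
have Nne : N%:R * n%:R * e <= 16^-1.
  rewrite /e !mulrA ler_pdivrMr// -ler_pdivrMl ?invr_gt0// invrK.
  have -> : 16 * (N%:R * n%:R * n%:R * K0%:R) = (16 * N * n ^ 2 * K0)%:R :> R.
    by rewrite !natrM; ring.
  by rewrite ler_nat.
have e0 : 0 <= e by rewrite /e !mulr_ge0.
have e16 : e <= 16^-1.
  by apply: le_trans Nne; rewrite ler_peMl// mulr_ege1.
have xe i : `|x i - dual_vec B k 0 i / N%:R| <= e by exact: pairing_grid_step.
have dN i : `|dual_vec B k 0 i / N%:R| <= 16^-1.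
  rewrite normrM (ger0_norm N_inv_ge0) ler_pdivrMr//.
  rewrite ler_pdivlMl//; apply: le_trans N_gamma; rewrite -mulrA ler_pM2l//.
  rewrite /dual_vec mxE; apply: le_trans (ler_norm_sum _ _ _) _.
  apply: (@le_trans _ _ (K0%:R * \sum_j `|invmx B i j|)).
    rewrite mulr_sumr; apply: ler_sum => j _; rewrite -trmx_inv !mxE normrM.
    by rewrite ler_wpM2r// -intr_norm -[K0%:R]/(K0%:Z%:~R) ler_int.
  rewrite ler_pM2l// /gamma [leRHS](bigD1 i)//= lerDl.
  by apply: sumr_ge0 => i' _; apply: sumr_ge0.
have x8 i : `|x i| <= 8^-1 by exact: norm_le_eighth (xe i) e16 (dN i).
have lx i : l (grid_step i) = 2 * pi * x i by [].
have l1 i : `|l (grid_step i)| <= 1 by rewrite lx norm_2pi_le1.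
(* Of the factor 1/2 left by [sqr_half_le], the rounding takes at most 1/8. *)
have sqx : 3 / 8 / N%:R ^+ 2 <= \sum_i x i ^+ 2.
  have d1 : 1 <= \sum_i dual_vec B k 0 i ^+ 2.
    have := dual_ge1 k0; rewrite -(@ler_pXn2r _ 2) ?nnegrE ?enorm_ge0// expr1n sqr_enorm.
    by move=> /le_trans; apply; rewrite le_eqVlt; apply/orP; left; apply/eqP/eq_bigr.
  apply: (@le_trans _ _ (\sum_i ((dual_vec B k 0 i / N%:R) ^+ 2 / 2 - e ^+ 2))).
    rewrite sumrB -mulr_suml sumr_const card_ord.
    under [X in X / 2]eq_bigr do rewrite expr_div_n.
    rewrite -mulr_suml ler_pdivrMr ?exprn_gt0// -[e ^+ 2 *+ n]mulr_natl.
    move: (\sum_i _) d1 => D D1.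
    have -> : (D / N%:R ^+ 2 / 2 - n%:R * e ^+ 2) * N%:R ^+ 2 =
        D / 2 - n%:R * e ^+ 2 * N%:R ^+ 2 by field; rewrite gt_eqF.
    have -> : 3 / 8 = 2^-1 - 8^-1 :> R by field.
    by apply: lerB (sqr_error_le N1 n1 e0 Nne); rewrite ler_pdivlMr// mulVf.
  by apply: ler_sum => i _; exact: sqr_half_le.
pose t i := 1 - cos (l (grid_step i)).
have t01 i : 0 <= t i <= 1.
  by rewrite subr_ge0 cos_le1 /= gerBl cos_ge0_small.
have sumt : 1 / 3 <= \sum_i \sum_(j < N ^ 2) t i.
  apply: (@le_trans _ _ (\sum_i N%:R ^+ 2 * (16 / 18 * x i ^+ 2))).
    rewrite -!mulr_sumr.
    have -> : 1 / 3 = N%:R ^+ 2 * (16 / 18 * (3 / 8 / N%:R ^+ 2)) :> R.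
      by field; rewrite gt_eqF.
    by rewrite ler_pM2l ?exprn_gt0// ler_pM2l.
  apply: ler_sum => i _; rewrite sumr_const card_ord -[leRHS]mulr_natl natrX ler_wpM2l ?sqr_ge0//.
  by rewrite /t lx sqr_le_cos// -lx.
have := @prod_subr_le R _ (index_enum ('I_n * 'I_(N ^ 2))%type) (fun ij => t ij.1)
  (fun ij => t01 ij.1).
rewrite -(pair_bigA _ (fun i _ => 1 - t i)) -(pair_bigA _ (fun i _ => t i)) /=.
under eq_bigr do under eq_bigr do rewrite subKr.
have P0 : 0 <= \prod_i \prod_(j < N ^ 2) cos (l (grid_step i)).
  apply: prodr_ge0 => i _; apply: prodr_ge0 => j _.
  by have /andP[_] := t01 i; rewrite /t gerBl.
move: (\prod_i _) (\sum_i \sum_(j < _) _) sumt P0 => P S S3 P0 PS.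
exact: one_sub_ge_quarter PS.
Qed.

End SpectralGap.

(** With x = 2 pi a / m, the Dirichlet kernel bounds the mean cosine by 6 / (S |x|). As |x| >= 4 K0
    / m and S K0 >= 2m, this is at most 3/4. *)
Lemma far_frequency_gap (R : realType) p K0 S (a : int) :
    (0 < S)%N -> (0 < K0)%N -> (2 * p.+2 <= S * K0)%N ->
    K0%:Z <= `|a| -> `|a| * 2 <= p.+2%:Z ->
  (4^-1 : R) <= \sum_(t < S) S%:R^-1 * (1 - cos (2 * pi * (a * t%:Z)%:~R / p.+2%:R)).
Proof.
move=> S0 K00 SK Ka am; have S_gt0 : 0 < S%:R :> R by rewrite ltr0n.
have m0 : 0 < p.+2%:R :> R by rewrite ltr0n.
have Kgt0 : 0 < K0%:R :> R by rewrite ltr0n.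
pose x : R := 2 * pi * a%:~R / p.+2%:R.
have -> : \sum_(t < S) S%:R^-1 * (1 - cos (2 * pi * (a * t%:Z)%:~R / p.+2%:R)) =
    1 - S%:R^-1 * \sum_(t < S) cos (t%:R * x) :> R.
  rewrite -mulr_sumr sumrB sumr_const card_ord mulrBr mulVf ?gt_eqF//.
  congr (1 - _ * _); apply: eq_bigr => t _; congr cos; rewrite /x intrM.
  by rewrite -[(t%:Z)%:~R]/(t%:R : R); ring.
have xE : `|x| = 2 * pi * `|a|%:~R / p.+2%:R.
  rewrite /x !normrM normfV intr_norm (ger0_norm (ltW m0)).
  by rewrite (ger0_norm (_ : 0 <= 2))// (ger0_norm (@pi_ge0 R)).
have aK : K0%:R <= `|a|%:~R :> R by rewrite -[K0%:R]/(K0%:Z%:~R) ler_int.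
have am' : `|a|%:~R * 2 <= p.+2%:R :> R.
  by rewrite -[2]/(2%:Z%:~R) -intrM -[p.+2%:R]/(p.+2%:Z%:~R) ler_int.
have x4 : `|x| <= 4.
  rewrite xE ler_pdivrMr//; have := @pi_lt4 R; have := @pi_gt0 R; nra.
have xK : 4 * K0%:R / p.+2%:R <= `|x|.
  rewrite xE ler_pM2r ?invr_gt0//; have := @pi_ge2 R; nra.
have x0 : 0 < `|x| by apply: lt_le_trans xK; rewrite divr_gt0// mulr_gt0.
suff : S%:R^-1 * \sum_(t < S) cos (t%:R * x) <= 3 / 4 by lra.
rewrite ler_pdivrMl//; apply: le_trans (sum_cos_le _ _) _; first by rewrite x0.
rewrite ler_pdivrMr//.
apply: le_trans (_ : S%:R * (3 / 4) * (4 * K0%:R / p.+2%:R) <= _); last first.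
  by rewrite ler_pM2l// mulr_gt0.
rewrite mulrA ler_pdivlMr//.
have : 2 * p.+2%:R <= S%:R * K0%:R :> R by rewrite -!natrM ler_nat.
nra.
Qed.

Lemma exists_natr_ge (R : realType) (x : R) : exists N, x <= N%:R /\ (0 < N)%N.
Proof.
exists (Num.truncn `|x|).+1; split=> //.
by apply: le_trans (ler_norm x) _; apply/ltW; rewrite truncnS_gt.
Qed.

Section StepLaw.
Context {R : realType} {n : nat} (B : 'M[R]_n).
Hypotheses (Bunit : B \in unitmx) (n_gt0 : (0 < n)%N).
Hypothesis dual_ge1 : forall z, z != 0 -> 1 <= enorm (dual_vec B z).

(* The law is a simple random walk of total length about sqrt n, which moves
   every frequency k with coordinates at most K0, plus uniform multiples of each
   basis vector of L up to the small multiple 3 / K0, for the other frequencies. *)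
Lemma exists_step_law : exists p0 : nat, forall p, (p0 <= p)%N ->
  exists s : seq (R * 'rV[int]_n),
  [/\ forall x, x \in s -> 0 <= x.1,
      forall k : 'rV['I_p.+2]_n, k != 0 ->
        4^-1 <= \sum_(x <- s) x.1 * (1 - cos (angle (dotm k (reduce p x.2))))
    & \sum_(x <- s) x.1 * enorm (pointZ p B x.2) <= 2 * Num.sqrt n%:R + 1].
Proof.
set beta : R := \sum_j enorm (row j B).
have beta0 : 0 <= beta by apply: sumr_ge0 => j _; exact: enorm_ge0.
have [K0 [K0_beta K0_gt0]] := exists_natr_ge (3 * beta).
have [N [N_gamma N_gt0]] := exists_natr_ge (16 * K0%:R * \sum_i \sum_j `|invmx B i j|).
have [p1 [p1_beta _]] := exists_natr_ge (N%:R * beta).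
exists (p1 + 16 * N * n ^ 2 * K0 + K0)%N => p pp.
have p_beta : N%:R * beta <= p.+2%:R by apply: le_trans p1_beta _; rewrite ler_nat; lia.
have p_N : (16 * N * n ^ 2 * K0 <= p.+2)%N by lia.
have K0p : (K0 <= p.+2)%N by lia.
pose vs := [seq grid_step B N p x.1 | x : 'I_n * 'I_(N ^ 2)].
(* About 2m / K0 multiples: enough for [far_frequency_gap], while S <= 3m / K0 keeps the cost of all
   the basis vectors at most 3 beta / K0 <= 1. *)
pose S := ((2 * p.+2) %/ K0).+1.
have S_lb : (2 * p.+2 <= S * K0)%N by apply/ltnW/ltn_ceil.
have S_ub : (S * K0 <= 3 * p.+2)%N.
  by rewrite /S mulSn; have := leq_divM (2 * p.+2) K0; lia.
(* Each basis vector carries total weight 1, to give a gap by itself; the total mass of the law is n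
   + 1. *)
pose far := [seq (S%:R^-1 : R, (delta_mx 0 x.1 : 'rV[int]_n) *+ x.2) | x : 'I_n * 'I_S].
exists ([seq (2 ^- size vs, z) | z <- walk vs] ++ far).
have m0 : 0 < p.+2%:R :> R by rewrite ltr0n.
have K00 : 0 < K0%:R :> R by rewrite ltr0n.
have S0 : 0 < S%:R :> R by rewrite ltr0n.
have far_sum (F : R * 'rV[int]_n -> R) : \sum_(x <- far) F x =
    \sum_j \sum_(t < S) F (S%:R^-1, delta_mx 0 j *+ t).
  by rewrite big_image /= (pair_bigA _ (fun j (t : 'I_S) => F (_, delta_mx 0 j *+ t))).
split.
- move=> x; rewrite mem_cat => /orP[/mapP[z _ ->]|/mapP[z _ ->]] /=.
    by rewrite invr_ge0 exprn_ge0.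
  by rewrite invr_ge0 ltW.
- move=> g g0; pose k : 'rV[int]_n := map_mx (@symrep p) g.
  have kg : reduce p k = g by apply/rowP => j; rewrite !mxE symrepK.
  have k0 : k != 0.
    by apply: contraNneq g0 => k0; rewrite -kg k0; apply/eqP/rowP => j; rewrite !mxE.
  rewrite big_cat big_map /= far_sum -kg.
  have c1 (a : 'I_p.+2) : 0 <= 1 - cos (angle a) :> R by rewrite subr_ge0 cos_le1.
  (* Either all coordinates of [k] are at most [K0], and the walk gives the gap, or some coordinate
     [j] is larger, and the multiples of the j-th basis vector give it. All other terms are
     nonnegative. *)
  have [kK|] := pselect (forall j, `|k 0 j| <= K0%:Z).
    apply: le_trans (walk_gap n_gt0 dual_ge1 K0_gt0 N_gt0 N_gamma p_N k0 kK) _.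
    rewrite lerDl; apply: sumr_ge0 => j _; apply: sumr_ge0 => t _.
    by rewrite mulr_ge0// invr_ge0 ltW.
  move=> /existsNP[j /negP]; rewrite -ltNge => kj.
  rewrite (bigD1 j)//= addrCA -[leLHS]addr0 lerD//; last first.
    rewrite addr_ge0//; apply: sumr_ge0 => i _; last apply: sumr_ge0 => t _.
      by rewrite mulr_ge0// invr_ge0 exprn_ge0.
    by rewrite mulr_ge0// invr_ge0 ltW.
  apply: le_trans (far_frequency_gap R _ K0_gt0 S_lb (ltW kj) _) _ => //.
    by rewrite mxE symrep_le.
  apply: ler_sum => t _; rewrite -[angle _ in leRHS]add0r cos_dotm_reduce add0r.
  rewrite (bigD1 j)//= big1 ?addr0 => [|i ij]; last first.
    by rewrite mulmxnE [delta_mx _ _ _ _]mxE (negbTE ij) andbF mul0rn mulr0.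
  by rewrite mulmxnE [delta_mx _ _ _ _]mxE !eqxx /= mulr1n natz.
rewrite big_cat big_map /= far_sum lerD//.
  exact: mean_walk_enorm.
apply: (@le_trans _ _ (\sum_j \sum_(t < S) p.+2%:R^-1 * enorm (row j B))).
  apply: ler_sum => j _; apply: ler_sum => t _.
  have -> : pointZ p B (delta_mx 0 j *+ t) = (t%:R / p.+2%:R) *: row j B.
    rewrite /pointZ (_ : map_mx _ _ = t%:R *: delta_mx 0 j); last first.
      by apply/rowP => i; rewrite mxE mulmxnE !mxE rmorphMn rmorph_nat mulr_natl.
    by rewrite scalerA -scalemxAl -rowE mulrC.
  rewrite enormZ mulrA ler_wpM2r ?enorm_ge0// ger0_norm ?divr_ge0// mulrA.
  rewrite ler_piMl ?invr_ge0 ?ler0n// ler_pdivrMl// mulr1 ler_nat; exact: ltnW.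
have -> : \sum_j \sum_(t < S) p.+2%:R^-1 * enorm (row j B) = S%:R * (p.+2%:R^-1 * beta).
  rewrite /beta !mulr_sumr; apply: eq_bigr => j _.
  by rewrite sumr_const card_ord [RHS]mulr_natl.
have SK : S%:R * K0%:R <= 3 * p.+2%:R :> R by rewrite -!natrM ler_nat.
rewrite mulrCA mulrC ler_pdivrMr// mul1r -(ler_pM2r K00) mulrAC.
apply: le_trans (ler_wpM2r beta0 SK) _.
by rewrite mulrAC mulrC ler_pM2l.
Qed.

End StepLaw.

(** * Few torsion points are close to the lattice *)

Section BinomialAverage.
Context {R : realType}.
Implicit Types (t th : R).
Local Open Scope complex_scope.

Definition cis t : R[i] := cos t +i* sin t.

Lemma cisD t th : cis (t + th) = cis t * cis th.
Proof. by apply/eqP; rewrite eq_complex /= cosD sinD !eqxx /= addrC (mulrC (sin t)) eqxx. Qed.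

Lemma cis0 : cis 0 = 1.
Proof. by rewrite /cis cos0 sin0. Qed.

Lemma cis_sum (I : Type) (s : seq I) (F : I -> R) :
  cis (\sum_(i <- s) F i) = \prod_(i <- s) cis (F i).
Proof. exact: (big_morph _ cisD cis0). Qed.

Lemma cisX t k : cis t ^+ k = cis (k%:R * t).
Proof.
elim: k => [|k IH]; first by rewrite mul0r cis0.
by rewrite exprS IH -cisD -nat1r mulrDl mul1r.
Qed.

(** The binomial theorem for (exp(- i t) + exp(i t))^M, that is, the characteristic function of a
    sum of [M] independent signs. *)
Lemma binomial_cis M t :
  \sum_(a < M.+1) ('C(M, a)%:R * cis (t * (2 * (a : nat)%:R - M%:R))) = ((2 * cos t) ^+ M)%:C.
Proof.
rewrite rmorphXn /= (_ : (2 * cos t)%:C = cis (- t) + cis t); last first.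
  by apply/eqP; rewrite eq_complex /= cosN sinN addNr eqxx andbT mulr_natl mulr2n.
rewrite exprDn; apply: eq_bigr => a _; rewrite mulr_natl; congr (_ *+ _).
rewrite !cisX -cisD natrB ?(leq_ord a)//; congr cis; ring.
Qed.

Lemma Re_sum (I : Type) (s : seq I) (F : I -> R[i]) :
  complex.Re (\sum_(i <- s) F i) = \sum_(i <- s) complex.Re (F i).
Proof. by apply: (big_morph (@complex.Re R)) => // -[x y] [x' y']. Qed.

(** Coordinates are independent, so characteristic functions multiply; the real part is then
    taken. *)
Lemma binomial_average_cos n M (th : 'I_n -> R) :
  \sum_(a : {ffun 'I_n -> 'I_M.+1}) (\prod_i 'C(M, a i)%:R) *
     cos (\sum_i th i * (2 * (a i : nat)%:R - M%:R)) =
  \prod_i (2 * cos (th i)) ^+ M.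
Proof.
rewrite -[RHS]/(complex.Re (\prod_i (2 * cos (th i)) ^+ M)%:C) rmorph_prod /=.
under [X in complex.Re X]eq_bigr do rewrite -binomial_cis.
rewrite bigA_distr_bigA Re_sum; apply: eq_bigr => a _.
rewrite big_split /= -cis_sum -natr_prod -natr_prod.
by rewrite -[_%:R in RHS](rmorph_nat (real_complex R)) /= mul0r subr0.
Qed.

End BinomialAverage.

Section Estimates.
Context {R : realType}.

Lemma bernoulli (t : R) j : 0 <= t <= 1 -> 1 - j%:R * t <= (1 - t) ^+ j.
Proof.
move=> /andP[t0 t1]; elim: j => [|j IH]; first by rewrite mul0r subr0.
rewrite exprSr; apply: le_trans (ler_wpM2r _ IH); last by rewrite subr_ge0.
rewrite -natr1; have : 0 <= j%:R * t ^+ 2 by rewrite mulr_ge0 ?sqr_ge0.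
by nra.
Qed.

Lemma geometric_le (x : R) T : 0 <= x < 1 -> \sum_(j < T) x ^+ j <= (1 - x)^-1.
Proof.
move=> /andP[x0 x1]; rewrite -[leRHS]div1r ler_pdivlMr ?subr_gt0//.
have -> : (\sum_(j < T) x ^+ j) * (1 - x) = 1 - x ^+ T.
  elim: T => [|T IH]; first by rewrite big_ord0 mul0r subrr.
  by rewrite big_ord_recr mulrDl IH exprS /=; ring.
by rewrite gerBl exprn_ge0.
Qed.

Lemma cos_exp_le (s : R) M : s ^+ 2 <= 1 -> expR (- (M%:R * s ^+ 2)) <= cos s ^+ M.
Proof.
move=> s1; rewrite -mulrN expRM_natl lerXn2r ?nnegrE ?expR_ge0//.
  by apply: le_trans (cos_ge s); lra.
apply: le_trans (cos_ge s); rewrite -[s ^+ 2 in leLHS](_ : 2 * (s ^+ 2 / 2) = _); last by field.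
by apply: expR_le_subr; have := sqr_ge0 s; lra.
Qed.

Lemma prod_cos_exp_le n (s : 'I_n -> R) M : (forall i, s i ^+ 2 <= 1) ->
  expR (- (M%:R * \sum_i s i ^+ 2)) <= \prod_i cos (s i) ^+ M.
Proof.
move=> s1; rewrite mulr_sumr -sumrN expR_sum; apply: ler_prod => i _.
by rewrite expR_ge0 cos_exp_le.
Qed.

Lemma truncn_eq_lt (x y : R) : 0 <= x -> 0 <= y -> Num.truncn x = Num.truncn y ->
  `|x - y| < 1.
Proof.
move=> x0 y0 xy; have /andP[x1 x2] := truncn_itv x0.
have /andP[y1 y2] := truncn_itv y0; rewrite xy in x1 x2.
by move: x2 y2; rewrite -natr1 ltr_norml; move: (_%:R) x1 y1 => c; lra.
Qed.

Lemma sign_norm_sub (x y : R) : (x < 0) = (y < 0) -> `|x - y| = `| `|x| - `|y| |.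
Proof.
have [x0|x0] := ltP x 0; have [y0|y0] := ltP y 0 => // _.
  by rewrite (ltr0_norm x0) (ltr0_norm y0) -[LHS]normrN; congr `|_|; ring.
by rewrite (ger0_norm x0) (ger0_norm y0).
Qed.

End Estimates.

(** * The Fourier transform of a set of torsion points at real frequencies *)

Section Spectrum.
Context {R : realType} {n p : nat} (L : lattice R n) (B : 'M[R]_n).
Hypothesis Bunit : B \in unitmx.
Hypothesis LB : lattice_set L =
  [set (map_mx intr z *m B)%R | z in [set: 'rV[int]_n]%classic]%classic.
Notation G := 'rV['I_p.+2]_n.
Variables (A : {set G}) (y : G -> 'rV[R]_n) (rho : R).
Hypothesis y_lattice : forall g, g \in A -> lattice_set L (y g).
Let u g := gpoint B g - y g.
Hypothesis u_le : forall g, g \in A -> enorm (u g) <= rho.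

(** The squared modulus of the Fourier transform of [A], extended from dual vectors to all
    frequencies. Short representatives of the points make it vary slowly in [x]. *)
Definition spectrum (x : 'rV[R]_n) : R :=
  energy (mem A) (fun g => 2 * pi * dotp (gpoint B g - y g) x).

Lemma spectrumE x : spectrum x =
  \sum_(g in A) \sum_(h in A) cos (2 * pi * dotp (u g - u h) x).
Proof.
rewrite /spectrum energyE; apply: eq_bigr => g _; apply: eq_bigr => h _.
by congr cos; rewrite (dotpBl (u g)) mulrBr.
Qed.

Lemma enorm_difference g h : g \in A -> h \in A -> enorm (u g - u h) <= 2 * rho.
Proof.
move=> gA hA; apply: le_trans (enormD _ _) _; rewrite enormN mulr_natl mulr2n.
by rewrite lerD ?u_le.
Qed.

(** Each phase difference is 2 pi times the pairing with a vector of norm at most 2 rho. *)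
Lemma spectrum_lipschitz x x' :
  spectrum x <= spectrum x' + #|A|%:R ^+ 2 * (4 * pi * rho * enorm (x - x')).
Proof.
set c := _ * enorm (x - x'); rewrite !spectrumE (expr2 #|A|%:R) -mulrA.
rewrite [#|A|%:R * _]mulr_natl -sumr_const -big_split /=.
apply: ler_sum => g gA; rewrite [#|A|%:R * _]mulr_natl -sumr_const -big_split /=.
apply: ler_sum => h hA; rewrite -lerBlDl; apply: le_trans (ler_norm _) _.
apply: le_trans (cos_lipschitz _ _) _; rewrite -mulrBr.
have -> : dotp (u g - u h) x - dotp (u g - u h) x' = dotp (u g - u h) (x - x').
  by rewrite !(dotpC (u g - u h)) dotpBl.
rewrite normrM ger0_norm ?mulr_ge0 ?pi_ge0//.
have -> : c = 2 * pi * (2 * rho * enorm (x - x')) by rewrite /c; ring.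
rewrite ler_wpM2l ?mulr_ge0 ?pi_ge0//; apply: le_trans (dotp_enorm_le _ _) _.
by rewrite ler_wpM2r ?enorm_ge0// enorm_difference.
Qed.

(** On translates of [x] by dual vectors, the spectrum is the squared Fourier transform, on the
    finite group, of a single function of modulus 1 on [A]. Distinct characters carry at most its
    total energy, given by Plancherel. *)
Lemma spectrum_bessel (I : finType) (P : {pred I}) (z : I -> 'rV[int]_n) x :
    {in P &, injective (reduce p \o z)} ->
  \sum_(i in P) spectrum (x + dual_vec B (z i)) <= #|{: G}|%:R * #|A|%:R.
Proof.
move=> zinj; pose phi g := 2 * pi * dotp (u g) x.
pose E k := energy (mem A) (fun g => phi g + angle (dotm k g)).
have -> : \sum_(i in P) spectrum (x + dual_vec B (z i)) = \sum_(i in P) E (reduce p (z i)).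
  apply: eq_bigr => i _; rewrite /spectrum /E !energyE.
  apply: eq_bigr => g gA; apply: eq_bigr => h hA.
  have dE g' : 2 * pi * dotp (u g') (x + dual_vec B (z i)) =
      phi g' + 2 * pi * dotp (u g') (dual_vec B (z i)).
    by rewrite /phi dotpC dotpDl !(dotpC _ (u g')) mulrDr.
  rewrite -!/(u _) !dE.
  have -> : phi g + 2 * pi * dotp (u g) (dual_vec B (z i)) -
      (phi h + 2 * pi * dotp (u h) (dual_vec B (z i))) =
      (phi g - phi h - 2 * pi * dotp (u h) (dual_vec B (z i))) +
        2 * pi * dotp (u g) (dual_vec B (z i)) by ring.
  rewrite /u (cos_dual_vec Bunit LB)//; last exact: y_lattice.
  rewrite -cosN.
  have -> : - (phi g - phi h - 2 * pi * dotp (gpoint B h - y h) (dual_vec B (z i)) +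
      angle (dotm (reduce p (z i)) g)) =
      (phi h - phi g - angle (dotm (reduce p (z i)) g)) +
        2 * pi * dotp (gpoint B h - y h) (dual_vec B (z i)) by ring.
  rewrite (cos_dual_vec Bunit LB)//; last exact: y_lattice.
  by rewrite -cosN; congr cos; ring.
rewrite -(plancherel (mem A) phi) -/(E _).
rewrite -(big_imset (E : G -> R) (h := reduce p \o z))//=.
rewrite [leRHS](bigID [in [set (reduce p \o z) x | x in P]])/= lerDl.
by apply: sumr_ge0 => k _; exact: energy_ge0.
Qed.

(** Each pair of points of [A] averages to a product of powers of cosines, and cos^M s >= exp(- M
    s^2). The exponents add up to at most n/2, and exp(-1/2) >= 1/2. *)
Lemma spectrum_average (tau : R) M : 0 <= rho -> 0 <= tau ->
    (2 * pi * tau) ^+ 2 * (2 * rho) ^+ 2 <= 1 ->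
    M%:R * ((2 * pi * tau) ^+ 2 * (2 * rho) ^+ 2) <= n%:R / 2 ->
  #|A|%:R ^+ 2 * (2 ^+ (M * n) * 2^-1 ^+ n) <=
  \sum_(a : {ffun 'I_n -> 'I_M.+1}) (\prod_i 'C(M, a i)%:R) *
     spectrum (\row_i (tau * (2 * (a i : nat)%:R - M%:R))).
Proof.
move=> rho0 tau0 small average.
under eq_bigr do rewrite spectrumE mulr_sumr.
set c := 2 ^+ _ * _; rewrite exchange_big /= (expr2 #|A|%:R) -mulrA.
rewrite [#|A|%:R * _]mulr_natl -sumr_const; apply: ler_sum => g gA.
under eq_bigr do rewrite mulr_sumr.
rewrite exchange_big /= [#|A|%:R * _]mulr_natl -sumr_const; apply: ler_sum => h hA.
pose v := u g - u h; pose s i := 2 * pi * tau * v 0 i.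
have -> : \sum_(a : {ffun 'I_n -> 'I_M.+1}) (\prod_i 'C(M, a i)%:R) *
    cos (2 * pi * dotp v (\row_i (tau * (2 * (a i : nat)%:R - M%:R)))) =
    \prod_i (2 * cos (s i)) ^+ M.
  rewrite -binomial_average_cos; apply: eq_bigr => a _; congr (_ * cos _).
  rewrite mulr_sumr; apply: eq_bigr => i _; rewrite /s; move: (v 0 i) => w.
  by rewrite mxE; ring.
have sum_s : \sum_i s i ^+ 2 <= (2 * pi * tau) ^+ 2 * (2 * rho) ^+ 2.
  have -> : \sum_i s i ^+ 2 = (2 * pi * tau) ^+ 2 * enorm v ^+ 2.
    by rewrite sqr_enorm mulr_sumr; apply: eq_bigr => i _; rewrite /s; ring.
  by rewrite ler_wpM2l ?sqr_ge0// lerXn2r ?nnegrE ?enorm_ge0 ?mulr_ge0// enorm_difference.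
have s1 i : s i ^+ 2 <= 1.
  apply: le_trans small; apply: le_trans sum_s; rewrite (bigD1 i)//= lerDl.
  by apply: sumr_ge0 => j _; exact: sqr_ge0.
under eq_bigr do rewrite exprMn.
rewrite /c big_split /= prodr_const card_ord -exprM ler_pM2l ?exprn_gt0//.
apply: le_trans (expR_ge_half_pow _ _) (le_trans _ (prod_cos_exp_le _ s1)).
by rewrite ler_expR lerN2; apply: le_trans average; rewrite ler_wpM2l.
Qed.

End Spectrum.

(** * Boxes for the displacements from the dual lattice *)

Section Cells.
Context {R : realType} {n : nat}.
Variables (T : nat) (tau : R).
Hypothesis tau_gt0 : 0 < tau.
Notation cell := {ffun 'I_n -> 'I_T.+1 * bool}.
Implicit Types (d : 'rV[R]_n) (c : cell).

(** Boxes of side [2 * tau], indexed in each coordinate by a sign and a truncated absolute value. In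
    all uses the ratios add up to at most [T], so [inord] never falls to its default value. *)
Definition cell_of d : cell :=
  [ffun i => (inord (Num.truncn (`|d 0 i| / (2 * tau))), d 0 i < 0)].

(** Not the midpoint, but the corner of the box nearest to the origin. *)
Definition cell_center c : 'rV[R]_n := \row_i ((-1) ^+ (c i).2 * (2 * tau * (c i).1%:R)).

Definition cell_norm c : nat := \sum_i (c i).1.

Let t0 : 0 < 2 * tau. Proof. by rewrite mulr_gt0. Qed.

Let ratio_ge0 (x : R) : 0 <= `|x| / (2 * tau).
Proof. by rewrite divr_ge0// ltW. Qed.

Let sum_truncn_le d : \sum_i `|d 0 i| / (2 * tau) <= T%:R ->
  (\sum_i Num.truncn (`|d 0 i| / (2 * tau))%R <= T)%N.
Proof.
rewrite -(ler_nat R) => /(le_trans _); apply; rewrite natr_sum; apply: ler_sum => i _.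
by rewrite truncn_le.
Qed.

Lemma cell_ofE d i : \sum_i `|d 0 i| / (2 * tau) <= T%:R ->
  (cell_of d i).1 = Num.truncn (`|d 0 i| / (2 * tau)) :> nat.
Proof.
move=> /sum_truncn_le dT; rewrite ffunE inordK// ltnS; apply: leq_trans dT.
by rewrite (bigD1 i)//= leq_addr.
Qed.

Lemma cell_norm_le d : \sum_i `|d 0 i| / (2 * tau) <= T%:R -> (cell_norm (cell_of d) <= T)%N.
Proof.
move=> dT; apply: leq_trans (sum_truncn_le dT); apply: leq_sum => i _.
by rewrite cell_ofE.
Qed.

Lemma cell_of_eq d d' i :
    \sum_i `|d 0 i| / (2 * tau) <= T%:R -> \sum_i `|d' 0 i| / (2 * tau) <= T%:R ->
  cell_of d = cell_of d' -> `|d 0 i - d' 0 i| < 2 * tau.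
Proof.
move=> dT dT' dd; have := congr1 (fun c : cell => nat_of_ord (c i).1) dd.
rewrite !cell_ofE// => /(truncn_eq_lt (ratio_ge0 _) (ratio_ge0 _)).
rewrite -mulrBl normrM (ger0_norm (_ : 0 <= (2 * tau)^-1)) ?invr_ge0 ?(ltW t0)//.
rewrite ltr_pdivrMr// mul1r -sign_norm_sub//.
by have /ffunP/(_ i) := dd; rewrite !ffunE => -[].
Qed.

Lemma cell_center_dist d : \sum_i `|d 0 i| / (2 * tau) <= T%:R ->
  enorm (d - cell_center (cell_of d)) <= Num.sqrt n%:R * (2 * tau).
Proof.
move=> dT; apply: enorm_le_sup => i; rewrite !mxE cell_ofE// ffunE /=.
set u := _ / _; have /andP[u1 u2] := truncn_itv (ratio_ge0 (d 0 i)); rewrite -/u in u1 u2.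
have du : `|d 0 i| = 2 * tau * u by rewrite /u mulrCA mulrV ?mulr1// unitfE gt_eqF.
have -> : d 0 i - (-1) ^+ (d 0 i < 0)%R * (2 * tau * (Num.truncn u)%:R) =
    (-1) ^+ (d 0 i < 0)%R * (2 * tau * (u - (Num.truncn u)%:R)).
  by rewrite [in RHS]mulrBr [RHS]mulrBr -du -realEsign ?num_real.
rewrite normrM normrX normrN1 expr1n mul1r normrM (ger0_norm (ltW t0)) ler_piMr ?(ltW t0)//.
by move: u2; rewrite -natr1 ger0_norm ?subr_ge0//; move: (_%:R) => w; lra.
Qed.

(** A generating function: the sum factors over the coordinates, and the two signs turn 4 into 8.
    For a suitable [x] every cell of small norm has weight at least 1, so the bound counts such
    cells. *)
Lemma sum_cell_weight (x : R) : 0 <= x < 1 ->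
  \sum_(c : cell) \prod_i (4 * x ^+ (c i).1) <= (8 * (1 - x)^-1) ^+ n.
Proof.
move=> x01; have /andP[x0 x1] := x01.
rewrite -(bigA_distr_bigA (fun=> fun jb : 'I_T.+1 * bool => 4 * x ^+ jb.1)) prodr_const card_ord.
rewrite lerXn2r ?nnegrE//.
- by apply: sumr_ge0 => jb _; rewrite mulr_ge0// exprn_ge0.
- by rewrite mulr_ge0// invr_ge0 subr_ge0 ltW.
rewrite -(pair_bigA _ (fun (j : 'I_T.+1) _ => 4 * x ^+ j)) /=.
rewrite (eq_bigr (fun j : 'I_T.+1 => 8 * x ^+ j)) => [|j _]; last first.
  by rewrite sumr_const card_bool mulr2n; ring.
rewrite -mulr_sumr.
by rewrite ler_pM2l// geometric_le.
Qed.

End Cells.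

(** The error term is half of the left side. After division by a 2^-n there remains a/2 <= 4^-n g <=
    g/4. *)
Lemma card_from_average (R : realType) (n : nat) (a g : R) : (0 < n)%N -> 0 <= a -> 0 <= g ->
  a ^+ 2 * 2^-1 ^+ n <= g * a * 8^-1 ^+ n + a ^+ 2 * (2^-1 * 2^-1 ^+ n) -> 2 * a <= g.
Proof.
move=> n0 a0 g0; have [->|aN0] := eqVneq a 0; first by move=> _; rewrite mulr0.
have {aN0}a0 : 0 < a by rewrite lt_neqAle eq_sym aN0.
have -> : 8^-1 = 2^-1 * 4^-1 :> R by field.
rewrite exprMn; have : 0 < 2^-1 ^+ n :> R by apply: exprn_gt0; lra.
have : 4^-1 ^+ n <= 4^-1 :> R.
  by rewrite -[leRHS]expr1 ler_wiXn2l//; lra.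
move: (2^-1 ^+ n) (4^-1 ^+ n) => u w w4 u0 H.
have {}H : a * u * (a * 2^-1) <= a * u * (g * w) by lra.
have {}H : a * 2^-1 <= g * w by rewrite -(ler_pM2l (mulr_gt0 a0 u0)).
have : g * w <= g * 4^-1 by rewrite ler_wpM2l.
by lra.
Qed.

Lemma small_residue_eq (m : nat) (a b u v r : int) : a = u * m%:Z + r -> b = v * m%:Z + r ->
  `|b| * 2 < m%:Z -> `|a| * 2 < m%:Z -> a = b.
Proof.
move=> -> -> b2 a2; suff -> : u = v by [].
have m0 : 0 < m%:Z by move: (v * m%:Z + r) b2 => w; lia.
have : `|u - v| * m%:Z < m%:Z.
  have -> : `|u - v| * m%:Z = `|(u * m%:Z + r) - (v * m%:Z + r)|.
    by rewrite (_ : _ - (_ + r) = (u - v) * m%:Z) ?normrM ?(gtr0_norm m0)//; ring.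
  by move: (u * m%:Z + r) (v * m%:Z + r) a2 b2 => w w'; lia.
by rewrite -[ltRHS]mul1r ltr_pM2r//; lia.
Qed.

(** * Counting the torsion points near the lattice *)

Section NearLattice.
Context {R : realType} {n : nat} (L : lattice R n) (B : 'M[R]_n).
Hypotheses (Bunit : B \in unitmx) (n_gt0 : (0 < n)%N).
Hypothesis LB : lattice_set L =
  [set (map_mx intr z *m B)%R | z in [set: 'rV[int]_n]%classic]%classic.
Hypothesis cover : forall x, exists z, enorm (x - dual_vec B z) <= 5.

(* The random frequency eta below has independent centred binomial coordinates
   tau * (2 Bin(M, 1/2) - M), of standard deviation tau * N = 256 / sqrt n; the
   factor 2^n in q makes tau small compared with 2^-n / rho. *)
Variables q N M T : nat.
Hypotheses (qE : q = (2 * n * 2 ^ n)%N) (NE : N = (256 * q)%N) (ME : M = (N ^ 2)%N).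
Hypothesis TE : T = (4 * q * n)%N.
Let sn : R := Num.sqrt n%:R.
Let tau : R := (sn * q%:R)^-1.
Let rho : R := n%:R / 8192.

Let q_gt0 : (0 < q)%N. Proof. by rewrite qE !muln_gt0 n_gt0 expn_gt0. Qed.
Let q0 : 0 < q%:R :> R. Proof. by rewrite ltr0n. Qed.
Let n0 : 0 < n%:R :> R. Proof. by rewrite ltr0n. Qed.
Let sn0 : 0 < sn. Proof. by rewrite sqrtr_gt0. Qed.
Let sn2 : sn ^+ 2 = n%:R. Proof. by rewrite sqr_sqrtr// ltW. Qed.
Let tau_gt0 : 0 < tau. Proof. by rewrite invr_gt0 mulr_gt0. Qed.

(** By Cauchy-Schwarz the sum is at most 5 sqrt n / (2 tau) = 5qn/2, which is below [T]. *)
Let spread_le (d : 'rV[R]_n) : enorm d <= 5 -> \sum_i `|d 0 i| / (2 * tau) <= T%:R.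
Proof.
move=> d5; rewrite -mulr_suml ler_pdivrMr ?mulr_gt0//.
apply: le_trans (sum_norm_le_enorm d) _; apply: (@le_trans _ _ (sn * 5)).
  by rewrite ler_pM2l.
rewrite /tau TE natrM (natrM _ 4 q) -sn2.
have -> : 4 * q%:R * sn ^+ 2 * (2 * (sn * q%:R)^-1) = 8 * sn.
  by field; rewrite !gt_eqF.
by rewrite mulrC ler_pM2r// ler_nat.
Qed.

Let x : R := 1 - (4 * q%:R)^-1.
Let x_bounds : 0 <= x < 1.
Proof.
rewrite /x gtrBl invr_gt0 mulr_gt0// subr_ge0 invf_le1 ?mulr_gt0//.
by rewrite -natrM ler1n muln_gt0 q_gt0.
Qed.

(** By Bernoulli x^(2q) >= 1/2, so x^T >= 4^-n, which the factors 4 compensate. *)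
Let weight_ge1 (c : {ffun 'I_n -> 'I_T.+1 * bool}) : (cell_norm c <= T)%N ->
  1 <= \prod_i (4 * x ^+ (c i).1).
Proof.
move=> cT; have /andP[x0 x1] := x_bounds.
rewrite big_split /= prodr_const card_ord -expr_sum.
apply: (@le_trans _ _ (4 ^+ n * x ^+ T)); last first.
  by rewrite ler_pM2l ?exprn_gt0// ler_wiXn2l// ltW.
have half : 2^-1 <= x ^+ (2 * q).
  apply: le_trans (bernoulli _ _).
    rewrite natrM (_ : 2 * q%:R / (4 * q%:R) = 2^-1); last by field; rewrite gt_eqF.
    by lra.
  by rewrite -[_ <= 1]subr_ge0 x0 andbT invr_ge0 mulr_ge0.
rewrite (_ : T = (2 * q * 2 * n)%N); last by rewrite TE; clear; lia.
rewrite exprM -exprMn exprn_ege1// exprM.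
have : 2^-1 ^+ 2 <= (x ^+ (2 * q)) ^+ 2 by rewrite lerXn2r ?nnegrE ?invr_ge0// exprn_ge0.
by move: ((x ^+ (2 * q)) ^+ 2) => w; lra.
Qed.

Let N_even : ~~ odd N. Proof. by rewrite NE oddM. Qed.

Let N_gt0 : (0 < N)%N. Proof. by rewrite NE muln_gt0 q_gt0. Qed.

Let pi16 : pi ^+ 2 <= 16 :> R.
Proof. by have := @pi_lt4 R; have := @pi_gt0 R; nra. Qed.

(** As tau N = 256 / sqrt n, the parameter q cancels. The constant 8192 in [rho] keeps pi^2 / 64
    below 1/2. *)
Let averageE : M%:R * ((2 * pi * tau) ^+ 2 * (2 * rho) ^+ 2) = n%:R * (pi ^+ 2 / 64).
Proof.
rewrite ME natrX NE natrM /rho /tau -sn2; field.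
by rewrite !gt_eqF.
Qed.

Let average_le : M%:R * ((2 * pi * tau) ^+ 2 * (2 * rho) ^+ 2) <= n%:R / 2.
Proof. by rewrite averageE ler_pM2l//; move: pi16 => h; lra. Qed.

Let small_le : (2 * pi * tau) ^+ 2 * (2 * rho) ^+ 2 <= 1.
Proof.
have M0 : 0 < M%:R :> R by rewrite ltr0n ME expn_gt0 N_gt0.
rewrite -(ler_pM2l M0) mulr1; apply: le_trans average_le _.
apply: (@le_trans _ _ n%:R); first by rewrite ler_pdivrMr// ler_peMr ?ler1n// ltW.
rewrite ler_nat ME; apply: (@leq_trans N); last by rewrite -{1}(expn1 N) leq_pexp2l.
by rewrite NE qE (mulnC 2 n) -mulnA mulnCA leq_pmulr// !muln_gt0 expn_gt0.
Qed.

(** Moving a frequency to the corner of its box must cost at most half of the main term 2^-n; the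
    value of [q] is chosen for this. *)
Let error_le : 4 * pi * rho * (sn * (2 * tau)) <= 2^-1 * 2^-1 ^+ n.
Proof.
have -> : 4 * pi * rho * (sn * (2 * tau)) = pi / 1024 * (n%:R / q%:R).
  by rewrite /rho /tau -sn2; field; rewrite !gt_eqF.
have -> : n%:R / q%:R = 2^-1 * 2^-1 ^+ n :> R.
  rewrite qE natrM (natrM _ 2 n) natrX exprVn; field.
  by rewrite expf_neq0 ?pnatr_eq0// gt_eqF.
have u1 : pi / 1024 <= 1 :> R by move: (@pi_lt4 R); lra.
have h0 : 0 <= 2^-1 * 2^-1 ^+ n :> R.
  by apply: mulr_ge0; [|apply: exprn_ge0]; rewrite invr_ge0.
by rewrite -[leRHS]mul1r; apply: ler_wpM2r.
Qed.

Let rho_ge0 : 0 <= rho. Proof. by apply: divr_ge0; exact: ler0n. Qed.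

Let error_enorm_le (v : 'rV[R]_n) : enorm v <= sn * (2 * tau) ->
  4 * pi * rho * enorm v <= 2^-1 * 2^-1 ^+ n.
Proof.
move=> v_le; apply: le_trans error_le; apply: ler_wpM2l v_le.
by apply: mulr_ge0 rho_ge0; apply: mulr_ge0 (@pi_ge0 R); exact: ler0n.
Qed.

Let eta (a : {ffun 'I_n -> 'I_M.+1}) : 'rV[R]_n :=
  \row_i (tau * (2 * (a i : nat)%:R - M%:R)).

Let eta_inj a b : (forall i, `|eta a 0 i - eta b 0 i| < 2 * tau) -> a = b.
Proof.
move=> ab; apply/ffunP => i; have := ab i; rewrite !mxE.
have -> : tau * (2 * (a i : nat)%:R - M%:R) - tau * (2 * (b i : nat)%:R - M%:R) =
    2 * tau * ((a i : nat)%:Z - (b i : nat)%:Z)%:~R by rewrite intrB; ring.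
rewrite normrM (ger0_norm (_ : 0 <= 2 * tau)) ?mulr_ge0 ?(ltW tau_gt0)//.
rewrite -[ltRHS]mulr1 ltr_pM2l ?mulr_gt0// -intr_norm -[1]/(1%:~R) ltr_int => abi.
by apply/val_inj => /=; move: (a i : nat) (b i : nat) abi => u v; clear; lia.
Qed.

Let sum_weights : \sum_(a : {ffun 'I_n -> 'I_M.+1}) \prod_i 'C(M, a i)%:R = 2 ^+ (M * n) :> R.
Proof.
transitivity (\prod_(i < n) (2 * cos 0) ^+ M : R).
  rewrite -(binomial_average_cos _ (fun=> 0)); apply: eq_bigr => a _.
  by rewrite [X in cos X]big1 ?cos0 ?mulr1// => i _; rewrite mul0r.
rewrite cos0 mulr1.
by rewrite prodr_const card_ord -exprM.
Qed.

Let weight_le (a : {ffun 'I_n -> 'I_M.+1}) :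
  \prod_i 'C(M, a i)%:R <= (2 ^+ M / N%:R) ^+ n :> R.
Proof.
rewrite -[n in leRHS]card_ord -prodr_const; apply: ler_prod => i _.
rewrite ler0n/= ler_pdivlMr ?ltr0n//; move: (nat_of_ord (a i)) => k.
by rewrite ME -natrX -natrM ler_nat bin_mul_le.
Qed.

Lemma near_lattice_card_aux : exists p0 : nat, forall p, (p0 <= p)%N ->
  forall A : {set 'rV['I_p.+2]_n},
    (forall g, g \in A -> exists2 y, lattice_set L y & enorm (gpoint B g - y) <= rho) ->
  2 * #|A|%:R <= #|{: 'rV['I_p.+2]_n}|%:R :> R.
Proof.
have [z zP] := boolp.choice (fun a => cover (eta a)).
pose d a := eta a - dual_vec B (z a).
have dT a : \sum_i `|d a 0 i| / (2 * tau) <= T%:R by apply: spread_le; exact: zP.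
pose cl a := cell_of T tau (d a).
(* For such [p] the coefficients of all the vectors [z a] are below m/2 in absolute value, so
   [reduce] separates the distinct ones. *)
exists (\sum_a \sum_j `|(z a 0 j)%R| * 2)%N => p pp A Anear.
have z_small a j : `|z a 0 j| * 2 < p.+2%:Z.
  have : (`|(z a 0 j)%R| * 2 <= p)%N.
    apply: leq_trans pp; rewrite (bigD1 a)//= (bigD1 j)//= -addnA leq_addr//.
  by clear; lia.
have [y0 yP] : exists y : 'rV['I_p.+2]_n -> 'rV[R]_n, forall g, g \in A ->
    lattice_set L (y g) /\ enorm (gpoint B g - y g) <= rho.
  have Y g : exists y, g \in A -> lattice_set L y /\ enorm (gpoint B g - y) <= rho.
    case: (boolP (g \in A)) => [/Anear[y Ly yr]|_]; first by exists y.
    by exists 0.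
  by have [y yP] := boolp.choice Y; exists y.
have yL g : g \in A -> lattice_set L (y0 g) by move=> /yP[].
have yr g : g \in A -> enorm (gpoint B g - y0 g) <= rho by move=> /yP[].
pose F := spectrum B A y0.
pose a0 : R := #|A|%:R; pose g0 : R := #|{: 'rV['I_p.+2]_n}|%:R.
have F0 v : 0 <= F v by exact: energy_ge0.
(* The frequencies eta a with the same cell are close to distinct translates of
   the centre of the cell by dual vectors. *)
have per_cell c : \sum_(a | cl a == c) F (cell_center tau c + dual_vec B (z a)) <=
    g0 * a0 * \prod_i (4 * x ^+ (c i).1).
  have w0 : 0 <= \prod_i (4 * x ^+ (c i).1).
    have /andP[x0 _] := x_bounds.
    by apply: prodr_ge0 => i _; rewrite mulr_ge0// exprn_ge0.
  have [[b bc]|none] := pselect (exists b, cl b = c); last first.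
    rewrite big1 ?mulr_ge0 // => a /eqP ac; case: none; by exists a.
  apply: (@le_trans _ _ (g0 * a0)); last first.
    by rewrite ler_peMr ?mulr_ge0// weight_ge1// -bc cell_norm_le.
  apply: (spectrum_bessel Bunit LB yL (P := [pred a | cl a == c])).
  move=> a a'; rewrite !inE => /eqP ac /eqP ac' /= zz.
  apply: eta_inj => i.
  have za : z a = z a'.
    apply/rowP => j; have := congr1 (fun g : 'rV['I_p.+2]_n => g 0 j) zz; rewrite !mxE.
    have [u uE] := @Zp_int p (z a 0 j); have [u' uE'] := @Zp_int p (z a' 0 j).
    move=> zz'; have := z_small a j; have := z_small a' j.
    move: uE uE'; rewrite -zz'; exact: small_residue_eq.
  have -> : eta a 0 i - eta a' 0 i = d a 0 i - d a' 0 i.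
    by rewrite /d za !mxE; ring.
  by apply: cell_of_eq; rewrite ?dT// -/(cl a) -/(cl a') ac ac'.
have sum_cells : \sum_a F (cell_center tau (cl a) + dual_vec B (z a)) <=
    g0 * a0 * (32 * q%:R) ^+ n.
  rewrite (partition_big cl predT)//=.
  apply: (@le_trans _ _ (\sum_(c : {ffun 'I_n -> 'I_T.+1 * bool})
      g0 * a0 * \prod_i (4 * x ^+ (c i).1))).
    apply: ler_sum => c _; apply: le_trans (per_cell c).
    by rewrite le_eqVlt; apply/orP; left; apply/eqP/eq_bigr => a /eqP ->.
  rewrite -mulr_sumr ler_wpM2l ?mulr_ge0//.
  apply: le_trans (sum_cell_weight _ x_bounds) _.
  by rewrite /x subKr invrK mulrA -natrM.
have lower := spectrum_average yr rho_ge0 (ltW tau_gt0) small_le average_le.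
(* Each frequency is replaced by its box corner plus a dual vector, then each binomial weight by its
   maximal value. *)
have upper : \sum_(a : {ffun 'I_n -> 'I_M.+1}) (\prod_i 'C(M, a i)%:R) * F (eta a) <=
    (2 ^+ M / N%:R) ^+ n * (g0 * a0 * (32 * q%:R) ^+ n) +
    2 ^+ (M * n) * (a0 ^+ 2 * (2^-1 * 2^-1 ^+ n)).
  apply: (@le_trans _ _ (\sum_(a : {ffun 'I_n -> 'I_M.+1}) (\prod_i 'C(M, a i)%:R) *
      (F (cell_center tau (cl a) + dual_vec B (z a)) + a0 ^+ 2 * (2^-1 * 2^-1 ^+ n)))).
    apply: ler_sum => a _; rewrite ler_wpM2l ?prodr_ge0//.
    apply: le_trans (spectrum_lipschitz yr _ (cell_center tau (cl a) + dual_vec B (z a))) _.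
    rewrite lerD2l; apply: ler_wpM2l (sqr_ge0 _) _ _ _; apply: error_enorm_le.
    have -> : eta a - (cell_center tau (cl a) + dual_vec B (z a)) =
        d a - cell_center tau (cl a) by rewrite /d opprD addrA addrAC.
    by apply: cell_center_dist.
  under eq_bigr do rewrite mulrDr.
  rewrite big_split /= -mulr_suml sum_weights lerD2r.
  apply: (@le_trans _ _ (\sum_(a : {ffun 'I_n -> 'I_M.+1}) (2 ^+ M / N%:R) ^+ n *
      F (cell_center tau (cl a) + dual_vec B (z a)))).
    by apply: ler_sum => a _; rewrite ler_wpM2r// weight_le.
  by rewrite -mulr_sumr ler_wpM2l// exprn_ge0// divr_ge0// exprn_ge0.
have := le_trans lower upper; rewrite -/a0 -/g0.
have -> : (2 ^+ M / N%:R) ^+ n * (g0 * a0 * (32 * q%:R) ^+ n) =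
    2 ^+ (M * n) * (g0 * a0 * 8^-1 ^+ n).
  (* The total cell weight (32 q)^n against N = 256 q. *)
  have -> : 8^-1 ^+ n = N%:R^-1 ^+ n * (32 * q%:R) ^+ n :> R.
    by rewrite -exprMn NE natrM; congr (_ ^+ _); field; rewrite gt_eqF.
  by rewrite exprM exprMn; ring.
rewrite mulrCA -mulrDr ler_pM2l ?exprn_gt0//.
by apply: card_from_average.
Qed.

End NearLattice.

Lemma near_lattice_card (R : realType) (n : nat) (L : lattice R n) (B : 'M[R]_n) :
    B \in unitmx -> (0 < n)%N ->
    lattice_set L = [set (map_mx intr z *m B)%R | z in [set: 'rV[int]_n]%classic]%classic ->
    (forall x, exists z, enorm (x - dual_vec B z) <= 5) ->
  exists p0 : nat, forall p, (p0 <= p)%N -> forall A : {set 'rV['I_p.+2]_n},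
    (forall g, g \in A -> exists2 y, lattice_set L y & enorm (gpoint B g - y) <= n%:R / 8192) ->
  2 * #|A|%:R <= #|{: 'rV['I_p.+2]_n}|%:R :> R.
Proof.
by move=> Bu n0 LB cover; exact: (near_lattice_card_aux Bu n0 LB cover erefl erefl erefl erefl).
Qed.

(** * Distortion of maps to L_1 *)

Section L1Sums.
Context {R : realType}.
Implicit Types s : seq (R * (L1 R * L1 R)).
Notation nonneg s := (all (fun x => 0 <= x.1) s).

Definition weighted_dist s (t : R) : R :=
  \sum_(x <- s) x.1 * `|(x.2.1 : R -> R) t - (x.2.2 : R -> R) t|.

Lemma weighted_dist_ge0 s t : nonneg s -> 0 <= weighted_dist s t.
Proof.
elim: s => [|x s IH] /=; rewrite /weighted_dist ?big_nil ?big_cons//.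
by move=> /andP[x0 s0]; rewrite addr_ge0 ?mulr_ge0 ?IH.
Qed.

Lemma measurable_weighted_dist s :
  measurable_fun [set: measurableTypeR R]%classic (weighted_dist s).
Proof.
apply: measurable_sum => x; apply: measurable_funM => //.
by apply: measurableT_comp => //; exact: L1_measurableB.
Qed.

Lemma L1_dist_sum s : nonneg s ->
  (\sum_(x <- s) x.1 * L1_dist x.2.1 x.2.2)%:E =
  (\int[lebesgue01]_t (weighted_dist s t)%:E)%E.
Proof.
elim: s => [|x s IH] /= => [_|/andP[x0 s0]].
  rewrite big_nil; under eq_integral do rewrite /weighted_dist big_nil.
  by rewrite integral0.
have mx : measurable_fun [set: measurableTypeR R]%classic
    (fun t => (`|(x.2.1 : R -> R) t - (x.2.2 : R -> R) t|)%:E).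
  by apply/measurable_EFinP/measurableT_comp => //; exact: L1_measurableB.
rewrite big_cons EFinD EFinM IH// L1_distE Lnorm1.
rewrite -[X in (_ * X)%E]/(\int[lebesgue01]_t (`|(x.2.1 : R -> R) t - (x.2.2 : R -> R) t|)%:E)%E.
rewrite -ge0_integralZl_EFin// -ge0_integralD//.
- by apply: eq_integral => t _; rewrite /weighted_dist big_cons EFinD EFinM.
- by move=> t _; rewrite -EFinM lee_fin mulr_ge0.
- exact: measurable_funeM.
- by move=> t _; rewrite lee_fin weighted_dist_ge0.
- by apply/measurable_EFinP; exact: measurable_weighted_dist.
Qed.

(** Both sides are integrals over [0, 1] of the pointwise sums. *)
Lemma L1_dist_sum_le s s' :
    nonneg s -> nonneg s' ->
    (forall t, weighted_dist s t <= weighted_dist s' t) ->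
  \sum_(x <- s) x.1 * L1_dist x.2.1 x.2.2 <= \sum_(x <- s') x.1 * L1_dist x.2.1 x.2.2.
Proof.
move=> s0 s'0 ss'; rewrite -lee_fin !L1_dist_sum//; apply: ge0_le_integral => //.
- by move=> t _; rewrite lee_fin weighted_dist_ge0.
- by apply/measurable_EFinP; exact: measurable_weighted_dist.
- by apply/measurable_EFinP; exact: measurable_weighted_dist.
- by move=> t _; rewrite lee_fin.
Qed.

Lemma poincare_L1 n p (s : seq (R * 'rV[int]_n)) (c : R) (f : 'rV['I_p.+2]_n -> L1 R) :
    0 <= c -> (forall x, x \in s -> 0 <= x.1) ->
    (forall k : 'rV['I_p.+2]_n, k != 0 ->
       c <= \sum_(x <- s) x.1 * (1 - cos (angle (dotm k (reduce p x.2))))) ->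
  c * \sum_x \sum_y L1_dist (f x) (f y) <=
  #|{: 'rV['I_p.+2]_n}|%:R * \sum_(z <- s) z.1 * \sum_x L1_dist (f (x + reduce p z.2)) (f x).
Proof.
move=> c0 s0 gap; set G := 'rV['I_p.+2]_n.
(* The two sides as weighted lists of pairs. [lhsE] and [rhsE] hold for every [F], to serve both for
   [L1_dist] and for pointwise distances. *)
pose lhs := [seq (c, (f x.1, f x.2)) | x <- index_enum (G * G)%type].
pose rhs := [seq (#|{: G}|%:R * x.1.1, (f (x.2 + reduce p x.1.2), f x.2)) |
  x <- [seq (z, x) | z <- s, x <- index_enum G]].
have lhsE (F : L1 R -> L1 R -> R) : \sum_(x <- lhs) x.1 * F x.2.1 x.2.2 =
    c * \sum_x \sum_y F (f x) (f y).
  rewrite big_map /= -(pair_bigA _ (fun x y => c * F (f x) (f y))) mulr_sumr.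
  by apply: eq_bigr => x _; rewrite mulr_sumr.
have rhsE (F : L1 R -> L1 R -> R) : \sum_(x <- rhs) x.1 * F x.2.1 x.2.2 =
    #|{: G}|%:R * \sum_(z <- s) z.1 * \sum_x F (f (x + reduce p z.2)) (f x).
  rewrite big_map big_allpairs /= mulr_sumr; apply: eq_bigr => z _.
  by rewrite mulrA mulr_sumr.
rewrite -(lhsE L1_dist) -(rhsE L1_dist); apply: L1_dist_sum_le => [||t].
- by rewrite all_map; apply/allP.
- rewrite all_map; apply/allP => _ /allpairsP[[z x] [zs _ ->]] /=.
  by rewrite mulr_ge0// s0.
rewrite /weighted_dist (lhsE (fun u v : L1 R => `|(u : R -> R) t - (v : R -> R) t|)).
rewrite (rhsE (fun u v : L1 R => `|(u : R -> R) t - (v : R -> R) t|)).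
exact: (poincare (fun x => (f x : R -> R) t)).
Qed.

End L1Sums.

(** With s = sqrt n: g^2 s^2 / 16384 <= e S <= 4 d e g^2 (2s + 1) <= 12 d e g^2 s. *)
Lemma distortion_arith (R : realFieldType) (g S s n d e : R) : 0 < g -> 1 <= s -> s ^+ 2 = n ->
    0 <= d -> 0 <= e -> g ^+ 2 * (n / 8192 / 2) <= e * S ->
    4^-1 * S <= g ^+ 2 * (d * (2 * s + 1)) ->
  s / (8192 * 24) <= d * e.
Proof.
move=> g0 s1 <- d0 e0 lower upper; have s0 : 0 < s by apply: lt_le_trans s1.
have g2 : 0 < g ^+ 2 by rewrite exprn_gt0.
have H1 : e * (4^-1 * S) <= e * (g ^+ 2 * (d * (2 * s + 1))) by rewrite ler_wpM2l.
have H2 : d * e * (2 * s + 1) <= d * e * (3 * s) by rewrite ler_wpM2l ?mulr_ge0//; lra.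
have H3 : g ^+ 2 * (s * (s / (8192 * 8))) <= g ^+ 2 * (s * (3 * (d * e))).
  apply: (@le_trans _ _ (g ^+ 2 * (d * e * (2 * s + 1)))); last first.
    by rewrite ler_pM2l// (_ : s * _ = d * e * (3 * s)) //; ring.
  move: lower H1; lra.
rewrite !ler_pM2l// in H3; lra.
Qed.

Lemma lattice_dist_ge0 (R : realType) n (L : lattice R n) x : 0 <= lattice_dist L x.
Proof.
apply: lb_le_inf (@lattice_dist_lbound _ _ L x).
by have [] := has_inf_lattice_dist L x.
Qed.

(** * The lower bound for the torus *)

Section TorusDistortion.
Context {R : realType} {n : nat} (L : lattice R n).
Hypothesis n_gt0 : (0 < n)%N.
Hypothesis dual_shortest : shortest (dual L) = 1%E.
Hypothesis dual_covering : (covering_radius (dual L) <= 4%:E)%E.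

Lemma dist_pi (x y : 'rV[R]_n) : 
  torus_dist (\pi_(torus L)%qT x) (\pi_(torus L)%qT y) = lattice_dist L (x - y).
Proof. exact: torus_distE. Qed.

Section Basis.
Variable B : 'M[R]_n.
Hypothesis Bunit : B \in unitmx.
Hypothesis LB : lattice_set L =
  [set (map_mx intr z *m B)%R | z in [set: 'rV[int]_n]%classic]%classic.

Lemma dual_vec_ge1 z : z != 0 -> 1 <= enorm (dual_vec B z).
Proof.
move=> z0; rewrite -lee_fin -[leLHS]dual_shortest; apply: ereal_inf_lbound.
exists (dual_vec B z) => //; split; first exact: dual_vec_dual.
by move=> /(dual_vec_eq0 Bunit) zE; rewrite zE eqxx in z0.
Qed.

(** The distance is an infimum; the slack between 4 and 5 pays for an approximate nearest point. *)
Lemma dual_vec_cover x : exists z, enorm (x - dual_vec B z) <= 5.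
Proof.
have x4 : lattice_dist (dual L) x <= 4.
  rewrite -lee_fin; apply: le_trans dual_covering; apply: ereal_sup_ubound.
  by exists x.
have [y Ly xy] := lattice_dist_adh (dual L) x ltr01.
have [z yE] := dual_vecP Bunit LB Ly; exists z; rewrite -yE.
by apply: le_trans (ltW xy) _; lra.
Qed.

Notation P := (fun g => \pi_(torus L)%qT (gpoint B g)).

Lemma torus_dist_shift p (g : 'rV['I_p.+2]_n) z :
  torus_dist (P (g + reduce p z)) (P g) = lattice_dist L (pointZ p B z).
Proof.
rewrite dist_pi -[RHS](lattice_distDl _ (gpoint_add LB g z)).
by congr lattice_dist; rewrite opprD addrA subrK.
Qed.

Lemma torus_dist_shiftG p (g h : 'rV['I_p.+2]_n) :
  torus_dist (P (g + h)) (P g) = lattice_dist L (gpoint B h).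
Proof. by rewrite -{1}(reduce_lift h) torus_dist_shift. Qed.

Let rho : R := n%:R / 8192.

(** At least half of the points are at distance [rho] or more from 0, and translation invariance
    reduces the double sum to distances from 0. *)
Lemma torus_mean_dist : exists p0 : nat, forall p, (p0 <= p)%N ->
  #|{: 'rV['I_p.+2]_n}|%:R ^+ 2 * (rho / 2) <=
  \sum_(x : 'rV['I_p.+2]_n) \sum_(y : 'rV['I_p.+2]_n) torus_dist (P x) (P y).
Proof.
have [p0 near] := near_lattice_card Bunit n_gt0 LB dual_vec_cover.
exists p0 => p /near {}near; set G := 'rV['I_p.+2]_n.
pose A := [set g : G | lattice_dist L (gpoint B g) < rho].
have A_le : 2 * #|A|%:R <= #|{: G}|%:R :> R.
  apply: near => g; rewrite inE -subr_gt0 => /(lattice_dist_adh L (gpoint B g))[y Ly yg].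
  by exists y => //; apply: le_trans (ltW yg) _; rewrite subrKC.
have rho0 : 0 <= rho by apply: divr_ge0; exact: ler0n.
have psi0 (g : G) : 0 <= lattice_dist L (gpoint B g) by exact: lattice_dist_ge0.
have sum_psi : #|{: G}|%:R * (rho / 2) <= \sum_(g : G) lattice_dist L (gpoint B g).
  apply: (@le_trans _ _ (\sum_(g in ~: A) rho)); last first.
    rewrite big_mkcond; apply: ler_sum => g _; case: ifP => //.
    by rewrite !inE -leNgt.
  rewrite sumr_const -[leRHS]mulr_natl.
  have := cardsC A; rewrite -cardsT => /(congr1 (fun k => k%:R : R)); rewrite natrD.
  rewrite cardsT; move: A_le.
  move: (#|A|%:R) (#|~: A|%:R) (#|G|%:R) => a b g ag gE.
  rewrite -gE in ag *.
  have : 0 <= (b - a) * rho by apply: mulr_ge0 rho0; lra.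
  by move: rho => r; lra.
rewrite exchange_big /= expr2 -mulrA [leLHS]mulr_natl -sumr_const.
apply: ler_sum => x _; apply: le_trans sum_psi _.
rewrite [leRHS](reindex_inj (addrI x)) /=; apply: ler_sum => g _.
by rewrite torus_dist_shiftG.
Qed.

End Basis.

(** The Poincare inequality bounds the mean L_1 distance of the images by [d] times the mean cost of
    a step; through [e] it is bounded below by the mean torus distance. *)
Lemma torus_lipschitz_bound (f : torus L -> L1 R) (d e : R) : 0 <= d -> 0 <= e ->
    (forall x y, L1_dist (f x) (f y) <= d * torus_dist x y) ->
    (forall x y, torus_dist x y <= e * L1_dist (f x) (f y)) ->
  Num.sqrt n%:R / (8192 * 24) <= d * e.
Proof.
move=> d0 e0 fd fe; have [B Bunit LB] := latticeP L.
have dual_ge1 := dual_vec_ge1 Bunit LB.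
have [p1 mean] := torus_mean_dist Bunit LB.
have [p2 law] := exists_step_law Bunit n_gt0 dual_ge1.
pose p := (p1 + p2)%N.
have {}mean := mean p (leq_addr _ _).
have [s [s0 gap cost]] := law p (leq_addl _ _).
set G := 'rV['I_p.+2]_n in mean gap.
pose P (g : G) := \pi_(torus L)%qT (gpoint B g).
have G0 : 0 < #|{: G}|%:R :> R by rewrite ltr0n; apply/card_gt0P; exists 0.
have q0 : 0 <= 4^-1 :> R by rewrite invr_ge0.
have poinc := poincare_L1 (f \o P) q0 s0 gap.
have upper : \sum_(z <- s) z.1 * \sum_x L1_dist (f (P (x + reduce p z.2))) (f (P x)) <=
    #|{: G}|%:R * (d * (2 * Num.sqrt n%:R + 1)).
  apply: (@le_trans _ _ (\sum_(z <- s) #|{: G}|%:R * (d * (z.1 * enorm (pointZ p B z.2))))).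
    rewrite big_seq [leRHS]big_seq; apply: ler_sum => z zs.
    have -> : #|{: G}|%:R * (d * (z.1 * enorm (pointZ p B z.2))) =
        z.1 * (#|{: G}|%:R * (d * enorm (pointZ p B z.2))) by ring.
    apply: ler_wpM2l (s0 _ zs) _ _ _; rewrite mulr_natl -sumr_const; apply: ler_sum => x _.
    apply: le_trans (fd _ _) _; rewrite ler_wpM2l// /P torus_dist_shift//.
    by have := lattice_dist_le (pointZ p B z.2) (lattice0 L); rewrite subr0.
  by rewrite -!mulr_sumr ler_pM2l// ler_wpM2l.
have lower : #|{: G}|%:R ^+ 2 * (n%:R / 8192 / 2) <=
    e * \sum_x \sum_y L1_dist (f (P x)) (f (P y)).
  apply: le_trans mean _; rewrite mulr_sumr; apply: ler_sum => x _.
  by rewrite mulr_sumr; apply: ler_sum => y _; exact: fe.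
have sn1 : 1 <= Num.sqrt n%:R :> R by rewrite -[leLHS]sqrtr1 ler_sqrt// ler1n.
apply: (@distortion_arith _ #|{: G}|%:R (\sum_x \sum_y L1_dist (f (P x)) (f (P y)))) => //.
  by rewrite sqr_sqrtr.
by rewrite expr2 -mulrA; apply: le_trans poinc _; rewrite ler_pM2l.
Qed.

Lemma torus_distinct_points : exists x y : torus L, x <> y.
Proof.
have [B Bunit LB] := latticeP L; have [p1 /(_ p1 (leqnn _))] := torus_mean_dist Bunit LB.
apply: contraPP => all_eq; apply/negP; rewrite -ltNge big1.
  apply: mulr_gt0; first by apply: exprn_gt0; rewrite ltr0n; apply/card_gt0P; exists 0.
  by have : 0 < n%:R :> R; [rewrite ltr0n|move: (n%:R) => r r0; lra].
move=> x _; apply: big1 => y _.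
rewrite (_ : \pi_(torus L)%qT (gpoint B x) = \pi_(torus L)%qT (gpoint B y)) ?torus_distxx//.
by apply: contrapT => xy; apply: all_eq; do 2!eexists; exact: xy.
Qed.

Lemma c1_torus_ge : ((Num.sqrt n%:R / (8192 * 24))%:E <= c1 (torus L))%E.
Proof.
apply: le_ereal_inf_tmp => _ [f _ <-]; rewrite /distortion; case: ifP => [/asboolP finj|_].
  2: exact: leey.
have d_le (x y : torus L) : x <> y ->
    ((L1_dist (f x) (f y) / torus_dist x y)%:E <= lipschitz_norm [set: torus L]%classic f)%E.
  by move=> xy; apply: ereal_sup_ubound; right; exists (x, y).
have e_le (x y : torus L) : x <> y ->
    ((torus_dist x y / L1_dist (f x) (f y))%:E <= lipschitz_norm_inv f)%E.
  by move=> xy; apply: ereal_sup_ubound; right; exists (x, y).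
have td0 (x y : torus L) : x <> y -> 0 < torus_dist x y.
  move=> xy; rewrite lt_neqAle (@metric_structure.mdist_ge0 R (torus L)) andbT.
  by apply/eqP => /esym/torus_dist_positivity.
have ld0 (x y : torus L) : x <> y -> 0 < L1_dist (f x) (f y).
  move=> xy; rewrite lt_neqAle (@metric_structure.mdist_ge0 R (L1 R)) andbT.
  by apply/eqP => /esym/L1_dist_positivity/finj.
have [x0 [y0 xy0]] := torus_distinct_points.
(* Both norms must be positive, since 0 times +oo is 0; then an infinite factor makes the distortion
   infinite. *)
have D0 : (0 < lipschitz_norm [set: torus L]%classic f)%E.
  by apply: lt_le_trans (d_le _ _ xy0); rewrite lte_fin divr_gt0 ?td0 ?ld0.
have E0 : (0 < lipschitz_norm_inv f)%E.
  by apply: lt_le_trans (e_le _ _ xy0); rewrite lte_fin divr_gt0 ?td0 ?ld0.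
move: (lipschitz_norm _ f) (lipschitz_norm_inv f) D0 E0 d_le e_le => D E D0 E0.
case: D D0 => [d||//] D0; last by rewrite gt0_mulye// leey.
case: E E0 => [e||//] E0; last by rewrite gt0_muley// leey.
move=> d_le e_le; rewrite -EFinM lee_fin; apply: (@torus_lipschitz_bound f).
- by rewrite lte_fin in D0; exact: ltW.
- by rewrite lte_fin in E0; exact: ltW.
- move=> x y; have [->|/eqP xy] := eqVneq x y; first by rewrite L1_distxx torus_distxx mulr0.
  by have := d_le _ _ xy; rewrite lee_fin ler_pdivrMr ?td0.
- move=> x y; have [->|/eqP xy] := eqVneq x y; first by rewrite L1_distxx torus_distxx mulr0.
  by have := e_le _ _ xy; rewrite lee_fin ler_pdivrMr ?ld0.
Qed.

End TorusDistortion.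

(** * Existence of lattices *)

Section HalfPoints.
Context {R : realType} {n : nat}.
Implicit Types (B : 'M[R]_n) (x y u v : 'rV[R]_n) (z w : 'rV[int]_n).

Definition zvec z : 'rV[R]_n := map_mx intr z.

Definition span_point B u : Prop := exists z, u = zvec z *m B.

Lemma span_pointD B u v : span_point B u -> span_point B v -> span_point B (u + v).
Proof. by move=> [z ->] [w ->]; exists (z + w); rewrite /zvec map_mxD mulmxDl. Qed.

Lemma span_pointN B u : span_point B u -> span_point B (- u).
Proof. by move=> [z ->]; exists (- z); rewrite /zvec map_mxN mulNmx. Qed.

Lemma span_pointB B u v : span_point B u -> span_point B v -> span_point B (u - v).
Proof. by move=> Bu /span_pointN; exact: span_pointD. Qed.

Definition admissible B : Prop :=
  [/\ B \in unitmx, forall z, span_point B (zvec z) &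
      forall u, span_point B u -> u != 0 -> 1 <= enorm u].

Lemma admissible1 : admissible 1%:M.
Proof.
split; first exact: unitmx1.
  by move=> z; exists z; rewrite mulmx1.
move=> _ [z ->]; rewrite mulmx1 => z0.
have [j zj] : exists j, z 0 j != 0.
  apply/existsP; apply: contraNT z0; rewrite negb_exists => /forallP h.
  by apply/eqP/rowP => j; have := h j; rewrite negbK !mxE => /eqP ->.
apply: le_trans (ler_coord_enorm _ j); rewrite mxE -intr_norm -[1]/(1%:~R) ler_int.
by move: zj; move: (z 0 j) => a; lia.
Qed.

(* The j-th row of B is replaced by (1/2) r B. As r has j-th coordinate 1,
   the change of basis is 1 + delta_j (r/2 - e_j), with integral inverse
   1 + delta_j (2 e_j - r). *)
Lemma admissible_step B y : admissible B -> span_point B (2 *: y) ->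
    (forall u, span_point B u -> 1 <= enorm (y - u)) ->
  exists2 B', admissible B' &
    (forall u, span_point B u -> span_point B' u) /\ span_point B' y.
Proof.
move=> [Bunit BZ B1] [z yz] y1.
pose r : 'rV[int]_n := \row_j ((z 0 j)%R %% 2)%Z.
pose h : 'rV[int]_n := \row_j ((z 0 j)%R %/ 2)%Z.
have zE : z = h *+ 2 + r.
  by apply/rowP => j; rewrite mxE mulmxnE !mxE [LHS](divz_eq _ 2); ring.
pose y' := 2^-1 *: (zvec r *m B).
have yE : y = zvec h *m B + y'.
  have -> : y = 2^-1 *: (2 *: y) by rewrite scalerA mulVf ?scale1r// pnatr_eq0.
  rewrite yz zE /zvec map_mxD mulmxDl scalerDr; congr (_ + _).
  rewrite (_ : map_mx _ _ = 2 *: map_mx intr h); last first.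
    by apply/rowP => j; rewrite mxE mulmxnE raddfMn !mxE mulr_natl.
  by rewrite -scalemxAl scalerA mulVf ?scale1r// pnatr_eq0.
have y'1 u : span_point B u -> 1 <= enorm (y' - u).
  move=> Bu; have -> : y' - u = y - (zvec h *m B + u) by rewrite yE (addrC _ y') addrKA.
  by apply: y1; apply: span_pointD => //; exists h.
have [j rj] : exists j, r 0 j = 1.
  have [j rj] : exists j, r 0 j != 0.
    apply/existsP; apply: contraPT (y'1 0 _) => [|]; last by exists 0; rewrite /zvec map_mx0 mul0mx.
    rewrite negb_exists => /forallP h0; apply/negP; rewrite -ltNge /y'.
    rewrite (_ : r = 0) ?/zvec ?map_mx0 ?mul0mx ?scaler0 ?subr0 ?enorm0//.
    by apply/rowP => j; have := h0 j; rewrite negbK [RHS]mxE => /eqP.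
  by exists j; move: rj; rewrite mxE; lia.
pose e : 'rV[int]_n := delta_mx 0 j.
pose dj : 'cV[R]_n := delta_mx j 0.
pose E : 'M[R]_n := 1%:M + dj *m (2^-1 *: zvec r - zvec e).
pose F : 'M[int]_n := 1%:M + delta_mx j 0 *m (e *+ 2 - r).
have ej : (zvec e *m dj = 1%:M).
  by apply/rowP => i; rewrite ord1 !mxE (bigD1 j)//= big1 ?addr0 => [|l lj];
    rewrite !mxE ?eqxx ?mulr1// (negbTE lj) andbF mul0r.
have rj1 : zvec r *m dj = 1%:M.
  by apply/rowP => i; rewrite ord1 mxE (bigD1 j)//= big1 ?addr0 => [|l lj];
    rewrite [dj _ _]mxE ?eqxx ?(negbTE lj) ?mulr0// [zvec r 0 j]mxE rj mxE mulr1.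
have FE : map_mx intr F *m E = 1%:M.
  have -> : map_mx intr F = 1%:M + dj *m (2 *: zvec e - zvec r).
    rewrite /F map_mxD map_mx1 map_mxM map_mxB map_delta_mx; congr (_ + _ *m (_ - _)).
    by apply/rowP => l; rewrite mxE mulmxnE raddfMn [RHS]mxE [in RHS]mxE mulr_natl.
  rewrite /E mulmxDr mulmx1 mulmxDl mul1mx -!addrA -[RHS]addr0; congr (_ + _).
  rewrite -mulmxA (mulmxA (2 *: zvec e - zvec r)) mulmxBl -scalemxAl ej rj1.
  rewrite -{2}[1%:M]scale1r -scalerBl (_ : 2 - 1 = 1 :> R); last by ring.
  rewrite scale1r mul1mx -mulmxDr -mulmxDr [X in _ *m X](_ : _ = 0) ?mulmx0//.
  by apply/rowP => l; rewrite !mxE; field.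
have EU : E \in unitmx by have [] := mulmx1_unit FE.
have wj w : zvec w *m dj = (w 0 j)%:~R%:M.
  by apply/rowP => i; rewrite ord1 mxE (bigD1 j)//= big1 ?addr0 => [|l lj];
    rewrite [dj _ _]mxE ?eqxx ?(negbTE lj) ?mulr0// mulr1 !mxE mulr1n.
have wE w : zvec w *m E = zvec (w - w 0 j *: e) + (w 0 j)%:~R *: (2^-1 *: zvec r).
  rewrite /E mulmxDr mulmx1 mulmxA wj mul_scalar_mx scalerBr addrA addrAC; congr (_ + _).
  by apply/rowP => l; rewrite !mxE intrB intrM.
pose B' := E *m B.
have BB' u : span_point B u -> span_point B' u.
  move=> [w ->]; exists (w *m F); rewrite /B' mulmxA; congr (_ *m _).
  by rewrite /zvec map_mxM -mulmxA FE mulmx1.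
have y'B' : span_point B' y'.
  exists e; rewrite /B' mulmxA wE (_ : e 0 j = 1); last by rewrite mxE !eqxx.
  by rewrite !scale1r subrr /zvec map_mx0 add0r -scalemxAl.
exists B'; last first.
  by split=> //; rewrite yE; apply: span_pointD => //; apply: BB'; exists h.
split; first by rewrite unitmx_mul EU.
  by move=> w; exact: BB' (BZ w).
move=> _ [w ->]; rewrite /B' mulmxA wE mulmxDl -scalemxAl -scalemxAl -/y'.
(* Even multiples of [y'] lie in the old lattice, so only the parity [b] matters: it gives an old
   point or a translate of [y']. *)
pose k := ((w 0 j)%R %/ 2)%Z; pose b := ((w 0 j)%R %% 2)%Z.
have -> : (w 0 j)%:~R *: y' = zvec (k *: r) *m B + b%:~R *: y'.
  have -> : zvec (k *: r) = k%:~R *: zvec r by apply/rowP => l; rewrite !mxE intrM.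
  rewrite -scalemxAl (divz_eq (w 0 j) 2) -/k -/b intrD scalerDl intrM -scalerA; congr (_ *: _ + _).
  by rewrite /y' scalerA mulfV ?scale1r// intr_eq0.
rewrite addrA -mulmxDl -/zvec; set u := (_ *m B).
have Bu : span_point B u.
  by exists (w - w 0 j *: e + k *: r); rewrite /zvec map_mxD.
have [b0|b1] : b = 0 \/ b = 1 by rewrite /b; lia.
  by rewrite b0 scale0r addr0; exact: B1.
move=> _; rewrite b1 scale1r addrC -[u]opprK; apply: y'1; exact: span_pointN.
Qed.

(** A pigeonhole bound for the index over Z^n: fractional parts fall into (2n)^n cubes of side
    1/(2n), and two lattice points in one cube are closer than 1, hence equal. *)
Lemma admissible_card B (I : finType) (a : I -> 'rV[R]_n) : (0 < n)%N -> admissible B ->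
    (forall i, span_point B (a i)) ->
    (forall i j z, a i - a j = zvec z -> i = j) ->
  (#|I| <= (2 * n) ^ n)%N.
Proof.
move=> n0 [_ BZ B1] aB ainj.
have N0 : 0 < (2 * n)%:R :> R by rewrite ltr0n muln_gt0.
pose fr i : 'rV[R]_n := \row_j (a i 0 j - (Num.floor (a i 0 j))%:~R).
have frE i : fr i = a i - zvec (\row_j Num.floor (a i 0 j)).
  by apply/rowP => j; rewrite !mxE.
have fr01 i j : 0 <= fr i 0 j < 1.
  rewrite mxE; have /andP[] := real_floor_itv (num_real (a i 0 j)).
  by rewrite intrD; move: (_%:~R) => f; lra.
have m_gt0 : (0 < 2 * n)%N by rewrite muln_gt0.
pose cell i : {ffun 'I_n -> 'I_(2 * n).-1.+1} :=
  [ffun j => inord (Num.truncn ((2 * n)%:R * fr i 0 j))].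
have cellE i j : cell i j = Num.truncn ((2 * n)%:R * fr i 0 j) :> nat.
  rewrite ffunE inordK// prednK// -(ltr_nat R).
  have /andP[f0 f1] := fr01 i j; have /andP[t0 _] := truncn_itv (mulr_ge0 (ltW N0) f0).
  by apply: le_lt_trans t0 _; rewrite gtr_pMr.
rewrite -[X in (X ^ n)%N](prednK m_gt0) -[(2 * n).-1.+1]card_ord.
rewrite -[X in (_ ^ X)%N]card_ord -card_ffun.
apply: (@leq_card _ _ cell) => i i' ii'.
have close j : `|(fr i - fr i') 0 j| < (2 * n)%:R^-1.
  have /andP[f0 _] := fr01 i j; have /andP[f0' _] := fr01 i' j.
  have := congr1 (fun c : {ffun _ -> 'I__} => nat_of_ord (c j)) ii'; rewrite !cellE.
  move=> /(truncn_eq_lt (mulr_ge0 (ltW N0) f0) (mulr_ge0 (ltW N0) f0')).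
  rewrite -mulrBr normrM (gtr0_norm N0) => H.
  by rewrite -[ltRHS]mulr1 ltr_pdivlMl// [(fr i - _) 0 j]mxE [(- fr i') 0 j]mxE.
have small : enorm (fr i - fr i') < 1.
  apply: le_lt_trans (enorm_le_sup (fun j => ltW (close j))) _.
  rewrite ltr_pdivrMr// mul1r; apply: (@le_lt_trans _ _ n%:R); last by rewrite ltr_nat; lia.
  rewrite -[leRHS](sqr_sqrtr (ler0n _ n)) expr2 ler_peMl ?sqrtr_ge0//.
  by rewrite -[leLHS]sqrtr1 ler_sqrt// ler1n.
have frB k : span_point B (fr k) by rewrite frE; exact: span_pointB.
have fr_eq : fr i = fr i'.
  apply/eqP; rewrite -subr_eq0; apply: contraTT small => ne0.
  by rewrite -leNgt B1//; exact: span_pointB.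
apply: (ainj _ _ ((\row_j Num.floor (a i 0 j)) - (\row_j Num.floor (a i' 0 j)))).
have swap (x p y q : 'rV[R]_n) : x - p = y - q -> x - y = p - q.
  by move=> H; rewrite -[x](subrK p) H addrAC addrC [y - q]addrC addrK addrC.
by rewrite /zvec map_mxB; apply: swap; rewrite -!/(zvec _) -!frE.
Qed.

(** Otherwise [admissible_step] applies forever. Each step doubles the number of known classes
    modulo Z^n, and 2^k > k contradicts [admissible_card] at k = (2n)^n. *)
Lemma exists_maximal : (0 < n)%N -> exists2 B, admissible B &
  forall y, span_point B (2 *: y) -> exists2 u, span_point B u & enorm (y - u) < 1.
Proof.
move=> n0; apply: contrapT => none.
have step B : admissible B -> exists2 y, span_point B (2 *: y) &
    forall u, span_point B u -> 1 <= enorm (y - u).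
  move=> Badm; apply: contrapT => no_y; apply: none; exists B => // y By.
  apply: contrapT => no_u; apply: no_y; exists y => // u Bu; rewrite leNgt; apply/negP => yu.
  by apply: no_u; exists u.
have chain k : exists B, exists (I : finType) (a : I -> 'rV[R]_n),
    [/\ admissible B, #|I| = (2 ^ k)%N, forall i, span_point B (a i) &
        forall i j z, a i - a j = zvec z -> i = j].
  elim: k => [|k [B [I [a [Badm cI aB ainj]]]]].
    exists 1%:M, unit, (fun=> 0); split=> //; first exact: admissible1.
    - by rewrite card_unit.
    - by move=> _; exists 0; rewrite /zvec map_mx0 mul0mx.
    - by move=> [] [].
  have [y y2 yfar] := step _ Badm; have [B' B'adm [BB' yB']] := admissible_step Badm y2 yfar.
  have yNB : ~ span_point B y by move=> /yfar; rewrite subrr enorm0 ler10.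
  have BZ : forall z, span_point B (zvec z) by have [] := Badm.
  (* The old classes and their translates by [y]. *)
  exists B', (I * bool)%type, (fun ib : I * bool => a ib.1 + (ib.2 : nat)%:R *: y); split=> //.
  - by rewrite card_prod card_bool cI expnSr.
  - move=> [i b] /=; apply: span_pointD; first exact: BB'.
    by case: b; rewrite ?scale1r// scale0r; exists 0; rewrite /zvec map_mx0 mul0mx.
  move=> [i b] [j b'] z /= ijz.
  have ajB := span_pointB (aB j) (aB i).
  case: b b' ijz => [] []; rewrite ?scale1r ?scale0r ?addr0 => ijz.
  - by have -> : i = j by apply: (ainj i j z); rewrite -ijz opprD addrACA subrr addr0.
  - case: yNB; have -> : y = zvec z + (a j - a i).
      by rewrite -ijz; apply/rowP => l; rewrite !mxE; ring.
    exact: span_pointD.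
  - case: yNB; have -> : y = - (zvec z + (a j - a i)).
      by rewrite -ijz; apply/rowP => l; rewrite !mxE; ring.
    exact/span_pointN/span_pointD.
  - by have -> : i = j by exact: (ainj i j z).
have [B [I [a [Badm cI aB ainj]]]] := chain ((2 * n) ^ n)%N.
have := admissible_card n0 Badm aB ainj; rewrite cI leqNgt ltn_expl//.
Qed.

(** If 2x is within r of a lattice point u, then u/2 is within 1 of another, so x is within r/2 + 1
    of it. Iterated from the crude bound [r0] + 2, the radius tends to 2. *)
Lemma maximal_cover B : B \in unitmx ->
    (forall y, span_point B (2 *: y) -> exists2 u, span_point B u & enorm (y - u) < 1) ->
  forall x, exists2 u, span_point B u & enorm (x - u) <= 4.
Proof.
move=> Bunit half; pose r0 : R := \sum_j enorm (row j B).
have iterate k x : exists2 u, span_point B u & enorm (x - u) <= r0 / 2 ^+ k + 2.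
  elim: k x => [|k IH] x.
    exists (zvec (\row_j Num.floor ((x *m invmx B) 0 j)) *m B); first by eexists.
    have -> : x - zvec (\row_j Num.floor ((x *m invmx B) 0 j)) *m B =
        (x *m invmx B - zvec (\row_j Num.floor ((x *m invmx B) 0 j))) *m B.
      by rewrite mulmxBl mulmxKV.
    rewrite expr0 divr1 -[leLHS]addr0 lerD//.
    rewrite -[leRHS]mul1r; apply: enorm_mulmx => j.
    rewrite [X in `|X|]mxE [(- _ : 'rV_n) 0 j]mxE [zvec _ 0 j]mxE [X in X%:~R]mxE.
    have /andP[] := real_floor_itv (num_real ((x *m invmx B) 0 j)).
    by rewrite intrD ler_norml; move: (_%:~R) => f; lra.
  have [u [z uE] xu] := IH (2 *: x).
  have [v Bv uv] : exists2 v, span_point B v & enorm (2^-1 *: u - v) < 1.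
    by apply: half; exists z; rewrite scalerA mulfV ?scale1r ?pnatr_eq0.
  exists v => //; have -> : x - v = 2^-1 *: (2 *: x - u) + (2^-1 *: u - v).
    by rewrite scalerBr scalerA mulVf ?pnatr_eq0// scale1r addrA subrK.
  apply: le_trans (enormD _ _) _; rewrite enormZ ger0_norm ?invr_ge0//.
  have -> : r0 / 2 ^+ k.+1 + 2 = 2^-1 * (r0 / 2 ^+ k + 2) + 1.
    by rewrite exprS; field; rewrite expf_neq0// pnatr_eq0.
  by rewrite lerD ?(ltW uv)// ler_wpM2l ?invr_ge0.
have [N [N_ge _]] := exists_natr_ge r0.
move=> x; have [u Bu xu] := iterate N x; exists u => //; apply: le_trans xu _.
suff : r0 / 2 ^+ N <= 1 by lra.
rewrite ler_pdivrMr ?exprn_gt0// mul1r; apply: le_trans N_ge _.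
by rewrite -natrX ler_nat ltnW// ltn_expl.
Qed.

(** [L] is the dual of the maximal lattice, so that its own dual is the maximal lattice. A unit
    vector of Z^n attains the minimum 1. *)
Lemma exists_dual_lattice : (0 < n)%N -> exists L : lattice R n,
  shortest (dual L) = 1%E /\ (covering_radius (dual L) <= 4%:E)%E.
Proof.
move=> n0; have [B [Bunit BZ B1] half] := exists_maximal n0.
have cover := maximal_cover Bunit half.
pose C := invmx B^T.
have Cunit : C \in unitmx by rewrite unitmx_inv unitmx_tr.
have Llat : is_lattice [set (map_mx intr z *m C)%R | z in [set: 'rV[int]_n]%classic]%classic.
  by exists C.
pose L := Lattice Llat; exists L.
have dualE z : dual_vec C z = zvec z *m B by rewrite /dual_vec /C (trmx_inv B^T) trmxK invmxK.
have dualP u : lattice_set (dual L) u <-> span_point B u.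
  split=> [/(dual_vecP (L := L) Cunit erefl)[z ->]|[z ->]]; first by exists z.
  by rewrite -dualE; apply: (dual_vec_dual (L := L) Cunit erefl).
split.
  apply/eqP; rewrite eq_le; apply/andP; split.
    rewrite -(enorm_delta (R := R) (Ordinal n0)); apply: ereal_inf_lbound.
    exists (delta_mx 0 (Ordinal n0)) => //; split.
      by apply/dualP; have := BZ (delta_mx 0 (Ordinal n0)); rewrite /zvec map_delta_mx.
    move=> /= d0; have := @enorm_delta R n (Ordinal n0); rewrite d0 enorm0.
    by move/eqP; rewrite eq_sym oner_eq0.
  apply: le_ereal_inf_tmp => _ [u [/dualP Bu u0] <-]; rewrite lee_fin B1//.
  by apply/eqP.
apply: ge_ereal_sup => _ [x _ <-]; rewrite lee_fin.
have [u /dualP Lu xu] := cover x.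
exact: le_trans (lattice_dist_le _ Lu) xu.
Qed.

End HalfPoints.

Local Open Scope classical_set_scope.

Theorem corollary5p2 (R : realType) :
  exists2 c : R, 0 < c &
    [/\ forall (n : nat) (L : lattice R n), (1 <= n)%N ->
          shortest (dual L) = 1%E -> (covering_radius (dual L) <= 4%:E)%E ->
          ((c * Num.sqrt n%:R)%:E <= c1 (torus L))%E,
        forall n : nat, (1 <= n)%N ->
          exists L : lattice R n,
            shortest (dual L) = 1%E /\ (covering_radius (dual L) <= 4%:E)%E
      & forall n : nat, (1 <= n)%N ->
          exists L : lattice R n, ((c * Num.sqrt n%:R)%:E <= c1 (torus L))%E].
Proof.
have c0 : 0 < (8192 * 24)^-1 :> R by rewrite invr_gt0; lra.
have bound n (L : lattice R n) : (1 <= n)%N -> shortest (dual L) = 1%E ->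
    (covering_radius (dual L) <= 4%:E)%E ->
    (((8192 * 24)^-1 * Num.sqrt n%:R)%:E <= c1 (torus L))%E.
  by move=> n1 sL cL; rewrite mulrC; exact: c1_torus_ge.
exists (8192 * 24)^-1 => //; split=> [n L|n n1|n n1]; first exact: bound.
  exact: exists_dual_lattice.
by have [L [sL cL]] := @exists_dual_lattice R n n1; exists L; exact: bound.
Qed.
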